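(* Let $T = U\circ K:\mathbf{BPos}\to\mathbf{BPos}$ be the Kalmbach monad, arising from the free-forgetful adjunction $K\dashv U$ between $\mathbf{BPos}$ (bounded posets) and $\mathbf{OMP}$ (orthomodular posets). The real unit interval $[0,1]$ (with its usual order, partial addition, complement $a\mapsto 1-a$ and multiplication) is, up to isomorphism, the unique non-initial, non-final, irreducible monoid in the full subcategory of the Eilenberg-Moore category $\mathbf{BPos}^T$ consisting of those algebras whose underlying objects lie in $\mathbf{BPos}_\omega$ (the $\omega$-complete bounded posets).
   Context: **Bounded posets.** A poset is bounded when it has a minimum $0$ and a maximum $1$. $\mathbf{BPos}$ is the category of bounded posets and order-preserving maps preserving $0$ and $1$. A bounded poset is $\omega$-complete when every increasing sequence $a_1\leq a_2\leq\cdots$ has a supremum; $\mathbf{BPos}_\omega$ is the full subcategory of $\mathbf{BPos}$ of $\omega$-complete bounded posets. (The one-element poset, with $0=1$, is allowed.) **Orthomodular posets.** An orthomodular poset (OMP) is a bounded poset $P$ with an operation $a\mapsto a^\perp$ such that, writing $a\perp b$ for $a\leq b^\perp$: $(a^\perp)^\perp=a$; $a\leq b\iff b^\perp\leq a^\perp$; $a\wedge a^\perp=0$; if $a\perp b$ then $a\vee b$ exists; and if $a\perp b$ then $b=a^\perp\wedge(a\vee b)$. An OMP morphism is a $\mathbf{BPos}$ morphism $f$ such that $a\perp b$ implies $f(a)\perp f(b)$ and $f(a\vee b)=f(a)\vee f(b)$. This gives the category $\mathbf{OMP}$, with forgetful functor $U:\mathbf{OMP}\to\mathbf{BPos}$.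 **Kalmbach monad.** $U$ has a left adjoint $K$, the Kalmbach extension: $K(P)$ is the set of finite chains of even length in $P$, written $[a_1<a_2<\cdots<a_{2n}]$, ordered by $[a_1<\cdots<a_{2n}]\leq[b_1<\cdots<b_{2m}]$ iff for every $1\leq i\leq n$ there is $1\leq j\leq m$ with $b_{2j-1}\leq a_{2i-1}<a_{2i}\leq b_{2j}$; the minimum is $\emptyset$, the maximum is $[0<1]$, $S^\perp=S\,\Delta\,\{0,1\}$, and $K(f)(S)=\Delta_{s\in S}\{f(s)\}$ ($\Delta$ is symmetric difference). $T:=U\circ K$ is the monad of this adjunction. **Effect algebras.** An effect algebra is a set $E$ with an element $0$, a partial binary operation $\oplus$ and a total unary operation $(\ )^\perp$ such that, writing $a\perp b$ when $a\oplus b$ is defined and $1:=0^\perp$: (i) if $a\perp b$ then $b\perp a$ and $a\oplus b=b\oplus a$; (ii) $a\perp 0$ and $a\oplus 0=a$; (iii) if $a\perp b$ and $(a\oplus b)\perp c$ then $b\perp c$, $a\perp(b\oplus c)$ and $(a\oplus b)\oplus c=a\oplus(b\oplus c)$; (iv) $a^\perp$ is the unique element with $a\oplus a^\perp=1$; (v) if $a\perp 1$ then $a=0$. It is a bounded poset under $a\leq b$ iff $a\oplus c=b$ for some $c$; this $c$ is unique and written $b\ominus a$. A homomorphism is a map $f$ with $f(1)=1$ such that $a\perp b$ implies $f(a)\perp f(b)$ and $f(a\oplus b)=f(a)\oplus f(b)$. $\mathbf{EA}$ is the resulting category. It is known (Jenča) that $\mathbf{EA}\cong\mathbf{BPos}^T$,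 by an isomorphism that is the identity on underlying posets: an effect algebra $E$ corresponds to the algebra $K(E)\to E$, $[a_1<\cdots<a_{2n}]\mapsto(a_2\ominus a_1)\oplus\cdots\oplus(a_{2n}\ominus a_{2n-1})$. The full subcategory in the claim thus corresponds to the category $\mathbf{EA}_\omega$ of $\omega$-complete effect algebras and all effect algebra homomorphisms. **Monoids.** $\mathbf{EA}$ is symmetric monoidal, with $E\otimes F$ the universal target of bimorphisms, i.e. maps $f:E\times F\to G$ with $f(1,1)=1$ that preserve defined sums in each variable separately (including definedness). Monoids for this tensor are exactly effect monoids: effect algebras $M$ with a total binary operation $\cdot$ that is associative, satisfies $x\cdot 1=x=1\cdot x$, and is such that $y\perp z$ implies $x\cdot y\perp x\cdot z$, $y\cdot x\perp z\cdot x$, $x\cdot(y\oplus z)=(x\cdot y)\oplus(x\cdot z)$ and $(y\oplus z)\cdot x=(y\cdot x)\oplus(z\cdot x)$. The monoids in the full subcategory in the claim are taken to be the effect monoids whose underlying poset is $\omega$-complete. Isomorphism means isomorphism of effect monoids. A monoid $M$ is irreducible when $M\cong M_1\times M_2$ (Cartesian product of monoids, pointwise operations) implies that $M_1$ or $M_2$ is final. The final object is $\{0\}$ and the initial object is $\{0,1\}$. **Unit interval.** On $[0,1]$: $a\perp b$ iff $a\leq 1-b$, $a\oplus b=a+b$, $a^\perp=1-a$, and $\cdot$ is the usual multiplication. *)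

(* Defs.v *)
From HB Require Import structures.
From mathcomp Require Import all_boot all_order all_algebra.
From mathcomp Require Import boolp classical_sets reals interval_inference.
Set Implicit Arguments.
Unset Strict Implicit.
Unset Printing Implicit Defensive.
Import Order.Theory.
Local Open Scope order_scope.

(* Bounded posets are tbPOrderTypes; \bot and \top may be equal. *)
Record bpos_hom d d' (P : tbPOrderType d) (Q : tbPOrderType d') := BposHom {
  bfun :> P -> Q;
  bfun_homo : {homo bfun : x y / x <= y};
  bfun0 : bfun \bot = \bot;
  bfun1 : bfun \top = \top }.

Definition bpos_id d (P : tbPOrderType d) : bpos_hom P P :=
  @BposHom d d P P idfun (fun _ _ h => h) erefl erefl.

Program Definition bpos_comp d d' d'' (P : tbPOrderType d) (Q : tbPOrderType d')
    (R : tbPOrderType d'') (g : bpos_hom Q R) (f : bpos_hom P Q) :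
  bpos_hom P R := @BposHom _ _ P R (fun x => g (f x)) _ _ _.
Next Obligation. by move=> *; do 2!apply: bfun_homo. Qed.
Next Obligation. by move=> *; rewrite !bfun0. Qed.
Next Obligation. by move=> *; rewrite !bfun1. Qed.

Definition omega_complete d (P : porderType d) :=
  forall a : nat -> P, (forall n, a n <= a n.+1) ->
  exists s, supremums (range a) s.

Definition is_join d (P : porderType d) (a b c : P) :=
  forall x, (c <= x) = (a <= x) && (b <= x).

Definition is_meet d (P : porderType d) (a b c : P) :=
  forall x, (x <= c) = (x <= a) && (x <= b).

Record orthomodular d (P : tbPOrderType d) := Orthomodular {
  perp : P -> P;
  perpK : forall a, perp (perp a) = a;
  perp_le : forall a b, (a <= b) = (perp b <= perp a);
  perp_meet : forall a, is_meet a (perp a) \bot;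
  perp_join : forall a b, a <= perp b -> exists c, is_join a b c;
  perp_omod : forall a b c,
    a <= perp b -> is_join a b c -> is_meet (perp a) c b }.

Record omp_hom d d' (P : tbPOrderType d) (Q : tbPOrderType d')
    (OP : orthomodular P) (OQ : orthomodular Q) := OmpHom {
  ofun :> bpos_hom P Q;
  ofun_perp : forall a b, a <= perp OP b -> ofun a <= perp OQ (ofun b);
  ofun_join : forall a b c, a <= perp OP b -> is_join a b c ->
    is_join (ofun a) (ofun b) (ofun c) }.

(* The symmetric difference of the singletons {y}, for y ranging over s. *)
Definition odd_part (T : eqType) (s : seq T) : seq T :=
  [seq y <- undup s | odd (count_mem y s)].

Section OddPart.
Context {T : eqType}.
Implicit Type s : seq T.

Lemma odd_count_odd_part a s : odd (count a (odd_part s)) = odd (count a s).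
Proof.
have E t : uniq t ->
    odd (count a [seq y <- t | odd (count_mem y s)])
    = odd (count (fun x => (x \in t) && a x) s).
  elim: t => [|y t IH] /=; first by rewrite (@eq_count _ _ pred0) ?count_pred0.
  move=> /andP[yt ut].
  have -> : count (fun x => (x \in y :: t) && a x) s
      = (count (fun x => (x == y) && a x) s
         + count (fun x => (x \in t) && a x) s)%N.
    rewrite -count_predUI -[LHS]addn0; congr addn.
      by apply: eq_count => x /=; rewrite inE andb_orl.
    apply/esym; rewrite (@eq_count _ _ pred0) ?count_pred0 // => x /=.
    by case: eqP => [->|]//=; rewrite (negPf yt)/= andbF.
  have -> : count (fun x => (x == y) && a x) s = (a y * count_mem y s)%N.
    case ay: (a y); rewrite ?mul1n ?mul0n.
      by apply: eq_count => x /=; case: eqP => [->|].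
    rewrite (@eq_count _ _ pred0) ?count_pred0 // => x /=.
    by case: eqP => [->|].
  rewrite oddD -(IH ut) oddM.
  by case: (odd (count_mem y s)) => /=; rewrite ?andbF ?oddD //; case: (a y).
rewrite /odd_part E ?undup_uniq //; congr odd; apply: eq_in_count => x xs.
by rewrite mem_undup xs.
Qed.

Lemma mem_odd_part s : {subset odd_part s <= s}.
Proof. by move=> x; rewrite mem_filter mem_undup => /andP[]. Qed.

Lemma odd_size_odd_part s : odd (size (odd_part s)) = odd (size s).
Proof. by rewrite -!(count_predT) odd_count_odd_part. Qed.
End OddPart.

Section Parity.
Context {d : Order.disp_t} {P : tbPOrderType d}.
Implicit Types (s t : seq P) (x y : P).

(* Membership of x in the union of the half-open intervals [s_2i, s_2i+1). *)
Definition par s x := odd (count (fun y => y <= x) s).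

Lemma odd_part_sorted s : sorted <=%O s -> sorted <%O (odd_part s).
Proof.
move=> ss; rewrite lt_sorted_uniq_le filter_uniq ?undup_uniq //=.
apply: (subseq_sorted le_trans _ ss).
exact: subseq_trans (filter_subseq _ _) (undup_subseq _).
Qed.

Lemma par_odd_part s x : par (odd_part s) x = par s x.
Proof. exact: odd_count_odd_part. Qed.

Lemma path_lt_nle x a s : ~~ (a <= x) -> path <%O a s ->
  count (fun y => y <= x) s = 0%N.
Proof.
rewrite lt_path_sortedE => ax /andP[/allP h _].
apply/eqP; rewrite -leqn0 leqNgt -has_count; apply/hasPn => y /h ay.
by apply: contra ax; apply: le_trans (ltW ay).
Qed.

Lemma ltn_count_le s x i : sorted <%O s ->
  (i < count (fun y => (y <= x)%O) s)%N = (i < size s)%N && (nth \bot s i <= x).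
Proof.
elim: s i => [|a s IH] i //= ss.
have [ax|nax] := boolP (a <= x).
  by case: i => [|i] /=; rewrite ?ax // add1n !ltnS IH ?(path_sorted ss).
rewrite (path_lt_nle nax ss) addn0 ltn0; apply/esym/negbTE.
case: i => [|i] /=; first by rewrite (negPf nax).
apply/negP; rewrite ltnS => /andP[si h]; case/negP: nax.
apply: le_trans h; move: ss; rewrite lt_path_sortedE => /andP[/allP h _].
by apply/ltW/h/mem_nth.
Qed.

Lemma par_count s x i : sorted <%O s -> (i < size s)%N ->
  nth \bot s i <= x -> ((i.+1 < size s)%N -> ~~ (nth \bot s i.+1 <= x)) ->
  par s x = ~~ odd i.
Proof.
move=> ss si h1 h2; rewrite /par.
have -> : count (fun y => y <= x) s = i.+1; last by [].
apply/eqP; rewrite eqn_leq (ltn_count_le x i ss) si h1 andbT leqNgt.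
rewrite (ltn_count_le x i.+1 ss) negb_and.
by have [/h2 ->|] := boolP (i.+1 < size s)%N; rewrite ?orbT.
Qed.

Lemma parP s x : sorted <%O s -> ~~ odd (size s) -> par s x ->
  exists i, [/\ (i < (size s)./2)%N, nth \bot s i.*2 <= x
    & ~~ (nth \bot s i.*2.+1 <= x)].
Proof.
rewrite /par => ss es; set k := count _ s => ok.
have ks : (k <= size s)%N by exact: count_size.
have ek : k = k./2.*2.+1 by rewrite -[LHS]odd_double_half ok.
have := odd_double_half (size s); rewrite (negPf es) add0n => Es.
have ks' : (k < size s)%N.
  by rewrite ltn_neqAle ks andbT; apply: contra es => /eqP <-.
exists k./2; split.
- by rewrite -ltn_double Es; apply: leq_trans ks; rewrite [X in (_ < X)%N]ek.
- by have := ltn_count_le x k./2.*2 ss; rewrite -/k [X in (_ < X)%N]ek ltnS leqnn => /esym/andP[].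
- have := ltn_count_le x k ss; rewrite -/k ltnn ks' /= [X in nth _ _ X]ek.
  by move=> <-.
Qed.

Lemma par_inj s t : sorted <%O s -> sorted <%O t -> par s =1 par t -> s = t.
Proof.
have par_hd a u : path <%O a u -> par (a :: u) a.
  rewrite lt_path_sortedE => /andP[/allP h _]; rewrite /par /= lexx.
  rewrite (@eq_in_count _ _ pred0) ?count_pred0 // => y /h.
  by move=> /lt_geF ->.
have le_hd a u x : path <%O a u -> par (a :: u) x -> a <= x.
  move=> h; apply: contraTT => nax.
  by rewrite /par /= (negPf nax) (path_lt_nle nax h).
elim: s t => [|a s IH] [|b t] //= ss st e.
- by have := e b; rewrite par_hd.
- by have := e a; rewrite par_hd.
have ab : a = b.
  apply/le_anti; rewrite (le_hd a s) ?e ?par_hd //=.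
  by rewrite (le_hd b t) // -e par_hd.
subst b; congr cons; apply: IH; rewrite ?(path_sorted ss) ?(path_sorted st) //.
by move=> x; have := e x; rewrite /par /= !oddD; apply: addbI.
Qed.
End Parity.

Section Kalmbach.
Context {d : Order.disp_t} (P : tbPOrderType d).

(* A chain of even length, listed in increasing order.  Ranks in a seq start
   at 0, so the pairs (a_2i-1, a_2i), 1 <= i <= n, of [a_1 < ... < a_2n] have
   ranks (i.*2, i.*2.+1) with i < n. *)
Record kalmbach := Kalmbach {
  kseq :> seq P;
  kseqP : sorted <%O kseq && ~~ odd (size kseq) }.

HB.instance Definition _ := [isSub for kseq].
HB.instance Definition _ := [Choice of kalmbach by <:].

Definition kle (S T : kalmbach) : bool :=
  [forall i : 'I_(size S)./2, exists j : 'I_(size T)./2,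
    (nth \bot T j.*2 <= nth \bot S i.*2)
    && (nth \bot S i.*2.+1 <= nth \bot T j.*2.+1)].

Lemma kseq_sorted (S : kalmbach) : sorted <%O S.
Proof. by case/andP: (kseqP S). Qed.

Lemma kseq_even (S : kalmbach) : odd (size S) = false.
Proof. by case/andP: (kseqP S) => _ /negPf. Qed.

Definition kcmp (S T : kalmbach) := {in kseq S & kseq T, forall x y, x >=< y}.

Lemma kpar_inj (S T : kalmbach) : par S =1 par T -> S = T.
Proof. by move=> e; apply/val_inj/par_inj; rewrite ?kseq_sorted. Qed.

Lemma klt_half (S : kalmbach) i :
  (i < (size S)./2)%N -> (i.*2.+1 < size S)%N.
Proof.
have := odd_double_half (size S); rewrite kseq_even add0n => <-.
by rewrite doubleK -doubleS leq_double.
Qed.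

Lemma knth_le (S : kalmbach) i j : (i < size S)%N -> (j < size S)%N ->
  (nth \bot S i <= nth \bot S j) = (i <= j)%N.
Proof. by move=> iS jS; rewrite (lt_sorted_leq_nth _ (kseq_sorted S)). Qed.

Lemma kleP (S T : kalmbach) :
  kle S T <-> kcmp S T /\ forall x, par S x -> par T x.
Proof.
split=> [/forallP H|[cST pST]].
  have {}H i : (i < (size S)./2)%N -> exists2 j, (j < (size T)./2)%N
      & (nth \bot T j.*2 <= nth \bot S i.*2)
        && (nth \bot S i.*2.+1 <= nth \bot T j.*2.+1).
    by move=> iS; have /existsP[j h] := H (Ordinal iS); exists j.
  split=> [a b aS bT|x].
    have [k kS <-] : exists2 k, (k < size S)%N & nth \bot S k = a.
      by exists (index a S); rewrite ?index_mem ?nth_index.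
    have [l lT <-] : exists2 l, (l < size T)%N & nth \bot T l = b.
      by exists (index b T); rewrite ?index_mem ?nth_index.
    have k2 : (k./2 < (size S)./2)%N.
      have := odd_double_half (size S); rewrite kseq_even add0n => Es.
      by rewrite -ltn_double Es; apply: leq_ltn_trans kS; rewrite -[leqRHS]odd_double_half leq_addl.
    have [j jT /andP[h1 h2]] := H _ k2.
    have jT1 := klt_half jT; have kS1 := klt_half k2.
    have ka : nth \bot S k./2.*2 <= nth \bot S k.
      by rewrite knth_le // ?(ltnW kS1) // -[leqRHS]odd_double_half leq_addl.
    have kb : nth \bot S k <= nth \bot S k./2.*2.+1.
      by rewrite knth_le // -[leqLHS]odd_double_half -add1n leq_add2r; case: odd.
    rewrite /Order.comparable; have [lj|jl] := leqP l j.*2.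
      apply/orP; right; apply: le_trans ka; apply: le_trans h1.
      by rewrite knth_le // ltnW.
    apply/orP; left; apply: le_trans kb _; apply: le_trans h2 _.
    by rewrite knth_le.
  move/(parP (kseq_sorted S)); rewrite kseq_even => /(_ isT)[i [iS h1 h2]].
  have [j jT /andP[g1 g2]] := H _ iS.
  rewrite (@par_count _ _ _ _ j.*2) ?kseq_sorted ?odd_double //.
  - exact: ltnW (klt_half jT).
  - exact: le_trans h1.
  - by move=> _; apply: contra h2; apply: le_trans.
apply/forallP => -[i iS] /=; apply/existsP.
have iS1 := klt_half iS.
have pS : par S (nth \bot S i.*2).
  rewrite (@par_count _ _ _ _ i.*2) ?kseq_sorted ?odd_double //.
    exact: ltnW.
  by move=> _; rewrite knth_le ?ltnn // ltnW.
have := parP (kseq_sorted T); rewrite kseq_even => /(_ _ isT (pST _ pS)).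
move=> [j [jT h1 h2]]; exists (Ordinal jT) => /=; rewrite h1 /=.
have jT1 := klt_half jT.
have lt1 : nth \bot S i.*2 < nth \bot T j.*2.+1.
  rewrite lt_leAnge h2 andbT.
  have := cST _ _ (mem_nth \bot (ltnW iS1)) (mem_nth \bot jT1).
  by rewrite /Order.comparable (negPf h2) orbF.
have := cST _ _ (mem_nth \bot iS1) (mem_nth \bot jT1).
case/orP => // h3; apply: contraT => nh.
have : par S (nth \bot T j.*2.+1).
  rewrite (@par_count _ _ _ _ i.*2) ?kseq_sorted ?odd_double ?(ltW lt1) //.
  exact: ltnW.
move/pST; rewrite (@par_count _ _ _ _ j.*2.+1) ?kseq_sorted //=.
  by rewrite odd_double.
move=> jT2; rewrite knth_le // ltnn //.
Qed.

Lemma kle_refl : reflexive kle.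
Proof. by move=> S; apply/forallP => i; apply/existsP; exists i; rewrite !lexx. Qed.

Lemma kle_anti : antisymmetric kle.
Proof.
move=> S T /andP[/kleP[_ h1] /kleP[_ h2]]; apply: kpar_inj => x.
by apply/idP/idP => [/h1|/h2].
Qed.

Lemma kle_trans : transitive kle.
Proof.
move=> T S U /forallP h1 /forallP h2; apply/forallP => i.
have /existsP[j /andP[a b]] := h1 i; have /existsP[k /andP[a' b']] := h2 j.
by apply/existsP; exists k; rewrite (le_trans a' a) (le_trans b b').
Qed.

HB.instance Definition _ :=
  Order.Le_isPOrder.Build d kalmbach kle_refl kle_anti kle_trans.

Lemma kle_def (S T : kalmbach) :
  S <= T <-> kcmp S T /\ forall x, par S x -> par T x.
Proof. exact: kleP. Qed.

Fact kbuild_subproof (s : seq P) : sorted <=%O s -> odd (size s) = false ->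
  sorted <%O (odd_part s) && ~~ odd (size (odd_part s)).
Proof. by move=> ss es; rewrite odd_part_sorted // odd_size_odd_part es. Qed.

Definition kbuild s (ss : sorted <=%O s) (es : odd (size s) = false) :=
  Kalmbach (kbuild_subproof ss es).

Definition k0 : kalmbach := @Kalmbach [::] isT.

Fact k1_subproof : sorted <=%O [:: \bot; \top : P].
Proof. by rewrite /= le0x. Qed.

(* The chain [0 < 1], which is empty if 0 = 1. *)
Definition k1 : kalmbach := kbuild k1_subproof erefl.

Fact kperp_subproof (S : kalmbach) : sorted <=%O (\bot :: rcons S \top).
Proof.
rewrite /= rcons_path lex1 andbT path_sortedE; last exact: le_trans.
rewrite (sub_sorted (@ltW _ _)) ?kseq_sorted // andbT.
by apply/allP => x _; rewrite le0x.
Qed.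

Fact kperp_even (S : kalmbach) : odd (size (\bot :: rcons S \top)) = false.
Proof. by rewrite /= size_rcons /= kseq_even. Qed.

(* The symmetric difference of S and {0, 1}. *)
Definition kperp (S : kalmbach) : kalmbach :=
  kbuild (kperp_subproof S) (kperp_even S).

Fact keta_subproof (a : P) : sorted <=%O [:: \bot; a].
Proof. by rewrite /= le0x. Qed.

Definition keta_fun (a : P) : kalmbach := kbuild (keta_subproof a) erefl.

Lemma par_kbuild s (ss : sorted <=%O s) (es : odd (size s) = false) x :
  par (kbuild ss es) x = par s x.
Proof. exact: par_odd_part. Qed.

Lemma kpar_top (S : kalmbach) : par S \top = false.
Proof.
by rewrite -(kseq_even S) /par (@eq_count _ _ predT) ?count_predT // => x /=; rewrite lex1.
Qed.

Lemma par_k1 x : par k1 x = (x != \top).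
Proof. by rewrite par_kbuild /par /= le0x addn0 le1x; case: eqP. Qed.

Lemma par_kperp (S : kalmbach) x : par (kperp S) x = (x != \top) && ~~ par S x.
Proof.
rewrite par_kbuild /par /= le0x -cats1 count_cat /= addn0 le1x.
rewrite !oddD -[odd (count _ _)]/(par S x).
by case: eqP => [->|_] /=; rewrite ?kpar_top ?addbF.
Qed.

Lemma par_keta a x : par (keta_fun a) x = ~~ (a <= x).
Proof. by rewrite par_kbuild /par /= le0x addn0; case: (a <= x). Qed.

Lemma kle0x (S : kalmbach) : k0 <= S.
Proof. by apply/kle_def; split. Qed.

Lemma kcmpC (S T : kalmbach) : kcmp S T -> kcmp T S.
Proof. by move=> h x y xT yS; rewrite comparable_sym; apply: h. Qed.

Lemma kcmpS (S : kalmbach) : kcmp S S.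
Proof. by have /kle_def[] := lexx S. Qed.

Lemma kcmp_sub (S T U : kalmbach) :
  {subset kseq U <= \bot :: \top :: kseq T} -> kcmp S T -> kcmp S U.
Proof.
move=> sub h x y xS /sub; rewrite !inE => /or3P[/eqP->|/eqP->|]; last exact: h.
  by rewrite /Order.comparable le0x orbT.
by rewrite /Order.comparable lex1.
Qed.

Lemma kperp_mem (S : kalmbach) :
  {subset kseq (kperp S) <= \bot :: \top :: kseq S}.
Proof.
by move=> x /mem_odd_part; rewrite !inE mem_rcons inE.
Qed.

Lemma kperpK (S : kalmbach) : kperp (kperp S) = S.
Proof.
apply: kpar_inj => x; rewrite !par_kperp; case: eqP => //= [->|_].
  by rewrite kpar_top.
by rewrite negbK.
Qed.

Lemma kcmp_perp (S T : kalmbach) : kcmp S T -> kcmp S (kperp T).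
Proof. exact/kcmp_sub/kperp_mem. Qed.

Lemma klex1 (S : kalmbach) : S <= k1.
Proof.
apply/kle_def; split=> [|x].
  by apply: (@kcmp_sub S k0) => // x /mem_odd_part.
by rewrite par_k1; apply: contraL => /eqP ->; rewrite kpar_top.
Qed.

HB.instance Definition _ := Order.hasBottom.Build d kalmbach kle0x.
HB.instance Definition _ := Order.hasTop.Build d kalmbach klex1.

Lemma kperp_homo (S T : kalmbach) : S <= T -> kperp T <= kperp S.
Proof.
move=> /kle_def[c h]; apply/kle_def; split.
  by apply/kcmp_perp/kcmpC/kcmp_perp.
by move=> x; rewrite !par_kperp => /andP[-> /=]; apply: contra; apply: h.
Qed.

Lemma kperp_le (S T : kalmbach) : (S <= T) = (kperp T <= kperp S).
Proof.
by apply/idP/idP => [|/kperp_homo]; [exact: kperp_homo|rewrite !kperpK].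
Qed.

Lemma kperp_meet (S : kalmbach) : is_meet S (kperp S) \bot.
Proof.
move=> U; apply/idP/idP => [|/andP[/kle_def[_ h1] /kle_def[_ h2]]].
  by rewrite lex0 => /eqP ->; rewrite !le0x.
suff -> : U = \bot by [].
apply: kpar_inj => x; apply/negbTE/negP => hx; have := h2 _ hx.
by rewrite par_kperp (h1 _ hx) andbF.
Qed.

(* The symmetric difference of two chains whose union is a chain. *)
Lemma kxor_ex (S T : kalmbach) : kcmp S T ->
  exists U : kalmbach, [/\ forall x, par U x = par S x (+) par T x,
    forall x, x \in kseq U -> (x \in kseq S) || (x \in kseq T) &
    forall D, odd (count D U) = odd (count D S) (+) odd (count D T)].
Proof.
move=> c; set s := sort <=%O (S ++ T).
have ss : sorted <=%O s.
  suff tot : {in kseq S ++ kseq T &, total <=%O}.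
    by apply: (sort_sorted_in tot); apply/allP.
  move=> x y; rewrite !mem_cat => /orP[xS|xT] /orP[yS|yT].
  - exact: kcmpS xS yS.
  - exact: c.
  - exact: (kcmpC c).
  - exact: kcmpS xT yT.
have es : odd (size s) = false.
  by rewrite size_sort size_cat oddD !kseq_even.
exists (kbuild ss es); split=> [x|x /mem_odd_part|D].
- by rewrite par_kbuild /par count_sort count_cat oddD.
- by rewrite mem_sort mem_cat.
- by rewrite odd_count_odd_part count_sort count_cat oddD.
Qed.

Lemma kxor_le (S T U V : kalmbach) :
  (forall x, x \in kseq U -> (x \in kseq S) || (x \in kseq T)) ->
  kcmp V S -> kcmp V T -> kcmp V U.
Proof. by move=> h c1 c2 x y xV /h/orP[]; [apply: c1|apply: c2]. Qed.

Lemma kperp_dis (S T : kalmbach) : S <= kperp T ->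
  kcmp S T /\ forall x, par S x -> ~~ par T x.
Proof.
move=> /kle_def[c h]; split; last by move=> x /h; rewrite par_kperp => /andP[].
by rewrite -[T]kperpK; apply: kcmp_perp.
Qed.

Lemma kjoin_ex (S T : kalmbach) : S <= kperp T ->
  exists U : kalmbach, [/\ is_join S T U,
    forall x, par U x = par S x (+) par T x,
    forall x, x \in kseq U -> (x \in kseq S) || (x \in kseq T) &
    forall D, odd (count D U) = odd (count D S) (+) odd (count D T)].
Proof.
move=> /kperp_dis[c dis]; have [U [pU mU cU]] := kxor_ex c.
exists U; split=> // V; apply/idP/andP => [UV|[/kle_def[c1 h1] /kle_def[c2 h2]]].
  split; apply: le_trans UV; apply/kle_def; split.
  - exact: (kxor_le mU (@kcmpS S) c).
  - by move=> x Sx; rewrite pU Sx (negPf (dis _ Sx)).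
  - exact: (kxor_le mU (kcmpC c) (@kcmpS T)).
  - move=> x Tx; rewrite pU Tx; case Sx: (par S x) => //.
    by have := dis _ Sx; rewrite Tx.
apply/kle_def; split.
  by apply: kcmpC; apply: (kxor_le mU); apply: kcmpC.
move=> x; rewrite pU; case Sx: (par S x); first by rewrite h1.
by rewrite addFb => /h2.
Qed.

Lemma is_join_uniq (S T U V : kalmbach) : is_join S T U -> is_join S T V -> U = V.
Proof. by move=> h1 h2; apply/le_anti; rewrite h1 -h2 lexx h2 -h1 lexx. Qed.

Lemma kjoin_par (S T U : kalmbach) : S <= kperp T -> is_join S T U ->
  (forall x, par U x = par S x (+) par T x) /\
  forall x, x \in kseq U -> (x \in kseq S) || (x \in kseq T).
Proof. by move=> /kjoin_ex[V [jV pV mV _]] jU; rewrite (is_join_uniq jU jV). Qed.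

Lemma kjoin_count (S T U : kalmbach) D : S <= kperp T -> is_join S T U ->
  odd (count D U) = odd (count D S) (+) odd (count D T).
Proof. by move=> /kjoin_ex[V [jV _ _ cV]] jU; rewrite (is_join_uniq jU jV). Qed.

Lemma kperp_join (S T : kalmbach) : S <= kperp T -> exists U, is_join S T U.
Proof. by move=> /kjoin_ex[U []]; exists U. Qed.

Lemma kperp_omod (S T U : kalmbach) : S <= kperp T -> is_join S T U ->
  is_meet (kperp S) U T.
Proof.
move=> ST jU; have [pU mU] := kjoin_par ST jU.
have [c dis] := kperp_dis ST.
have [V [pV mV _]] := kxor_ex (kxor_le mU (@kcmpS S) c).
have {pV} VT : V = T by apply: kpar_inj => x; rewrite pV pU addKb.
subst V; move=> W; apply/idP/andP => [WT|[/kle_def[c1 h1] /kle_def[c2 h2]]].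
  split; first by apply: le_trans WT _; rewrite kperp_le kperpK.
  by apply: le_trans WT _; have := jU U; rewrite lexx => /esym/andP[].
apply/kle_def; split.
  by apply: kxor_le mV _ c2; rewrite -[S]kperpK; apply: kcmp_perp.
move=> x Wx; have := h2 _ Wx; rewrite pU; have := h1 _ Wx.
by rewrite par_kperp => /andP[_ /negPf ->].
Qed.

Definition kalmbach_omp : orthomodular kalmbach :=
  Orthomodular kperpK kperp_le kperp_meet kperp_join kperp_omod.

Lemma keta_homo : {homo keta_fun : a b / a <= b}.
Proof.
move=> a b ab; apply/kle_def; split=> [x y /mem_odd_part + /mem_odd_part|x].
  rewrite !inE => /orP[]/eqP-> /orP[]/eqP->; rewrite /Order.comparable ?le0x ?ab ?orbT //.
by rewrite !par_keta; apply: contra; apply: le_trans.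
Qed.

Lemma keta0 : keta_fun \bot = \bot.
Proof. by apply: kpar_inj => x; rewrite par_keta le0x. Qed.

Lemma keta1 : keta_fun \top = \top.
Proof. exact: val_inj. Qed.

(* The unit: a |-> [0 < a], the empty chain if a = 0. *)
Definition keta : bpos_hom P kalmbach := BposHom keta_homo keta0 keta1.
End Kalmbach.
Arguments keta {d P}.

Lemma kalmbach_ind_eta d (P : tbPOrderType d) (R : kalmbach P -> Prop) :
  R \bot ->
  (forall S a b, kseq S = [:: a; b] -> S <= kperp (keta a) ->
     is_join S (keta a) (keta b) -> R S) ->
  (forall S T U, S <= kperp T -> is_join S T U -> R S -> R T -> R U) ->
  forall S, R S.
Proof.
move=> R0 Rp RU; have pairE (S : kalmbach P) (a b : P) : kseq S = [:: a; b] -> R S.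
  move=> Sab; have := kseq_sorted S; rewrite Sab /= andbT => ab.
  have pS x : par S x = (a <= x) && ~~ (b <= x).
    rewrite /par Sab /= addn0; have [bx|] := boolP (b <= x).
      by rewrite (le_trans (ltW ab) bx).
    by case: (a <= x).
  have cSa : kcmp S (keta a).
    apply: (@kcmp_sub _ _ _ S); last exact: kcmpS.
    by move=> x /mem_odd_part; rewrite Sab !inE => /orP[]/eqP->; rewrite eqxx ?orbT.
  have ST : S <= kperp (keta a).
    apply/kle_def; split; first exact: kcmp_perp.
    move=> x; rewrite par_kperp par_keta pS => /andP[-> nb]; rewrite andbT.
    by apply: contra nb => /eqP ->; rewrite lex1.
  have [U jU] := kperp_join ST; have [pU _] := kjoin_par ST jU.
  have UE : U = keta b.
    apply: kpar_inj => x; rewrite pU pS !par_keta.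
    have [bx|_] := boolP (b <= x); last by rewrite andbT addbN; case: (a <= x).
    by rewrite (le_trans (ltW ab) bx).
  by rewrite UE in jU; apply: Rp Sab ST jU.
suff H n : forall S : kalmbach P, (size S <= n)%N -> R S.
  by move=> S; apply: (H _ S (leqnn _)).
elim: n => [|n IH] S.
  rewrite leqn0 size_eq0 => /eqP S0.
  suff -> : S = \bot by [].
  exact: val_inj.
case ES : (kseq S) => [|a [|b s]] sn; first by apply: IH; rewrite ES.
  by have := kseq_even S; rewrite ES.
have ss := kseq_sorted S; rewrite ES in ss.
have /= es := kseq_even S; rewrite ES /= negbK in es.
have abP : sorted <%O [:: a; b] && ~~ odd (size [:: a; b]).
  by move: ss => /= /andP[-> _].
have sP : sorted <%O s && ~~ odd (size s).
  by rewrite es (path_sorted (path_sorted ss)).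
set S1 := Kalmbach abP; set S2 := Kalmbach sP.
have bs x : x \in s -> b < x.
  by move: ss => /= /andP[_]; rewrite lt_path_sortedE => /andP[/allP h' _] /h'.
have ab : a < b by case/andP: ss.
have dis x : par S1 x -> ~~ par S2 x.
  rewrite /par /= addn0; have [bx|nbx] := boolP (b <= x).
    by rewrite (le_trans (ltW ab) bx).
  move=> _; rewrite (@eq_in_count _ _ pred0) ?count_pred0 // => y /bs bly.
  by apply/negbTE; apply: contra nbx => /(le_trans (ltW bly)).
have pS x : par S x = par S1 x (+) par S2 x.
  by rewrite /par ES /= addn0 addnA oddD.
have c12 : kcmp S1 S2.
  move=> x y xS yS; apply: (@kcmpS _ _ S); rewrite ES ?inE.
    by move: xS; rewrite !inE => /orP[]->; rewrite ?orbT.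
  by rewrite [y \in s]yS !orbT.
have le12 : S1 <= kperp S2.
  apply/kle_def; split; first exact: kcmp_perp.
  move=> x S1x; rewrite par_kperp dis // andbT.
  by apply: contraL S1x => /eqP ->; rewrite kpar_top.
have [U jU] := kperp_join le12; have [pU _] := kjoin_par le12 jU.
have US : U = S by apply: kpar_inj => x; rewrite pU pS.
rewrite US in jU; apply: RU le12 jU _ _; first exact: (@pairE _ a b).
exact/(IH S2)/ltnW.
Qed.

(* a (+) b = c is encoded as oplus a b = Some c.  The zero is the minimum of
   the poset, the order is the one of the effect algebra (ea_le), so that
   1 = 0^perp is the maximum (lemma ocompl0). *)
Record effect_algebra d (E : tbPOrderType d) := EffectAlgebra {
  oplus : E -> E -> option E;
  ocompl : E -> E;
  ea_le : forall a b, a <= b <-> exists c, oplus a c = Some b;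
  oplusC : forall a b c, oplus a b = Some c -> oplus b a = Some c;
  oplus0 : forall a, oplus a \bot = Some a;
  oplusA : forall a b c ab s, oplus a b = Some ab -> oplus ab c = Some s ->
    exists bc, oplus b c = Some bc /\ oplus a bc = Some s;
  ocomplP : forall a b, oplus a b = Some \top <-> b = ocompl a;
  oplus1 : forall a s, oplus a \top = Some s -> a = \bot }.

Section EffectAlgebraTheory.
Context {d : Order.disp_t} {E : tbPOrderType d} (A : effect_algebra E).
Local Notation "a ^c" := (ocompl A a).
Implicit Types a b c : E.

Lemma ocompl0 : \bot^c = \top.
Proof. by apply/esym/(ocomplP A)/oplusC/oplus0. Qed.

Lemma oplus0l a : oplus A \bot a = Some a.
Proof. exact/oplusC/oplus0. Qed.

Lemma oplus_compl a : oplus A a a^c = Some \top.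
Proof. exact/(ocomplP A). Qed.

Lemma ocomplK a : a^c^c = a.
Proof. exact/esym/(ocomplP A)/oplusC/oplus_compl. Qed.

Lemma ocompl1 : \top^c = \bot.
Proof. by rewrite -ocompl0 ocomplK. Qed.

Lemma oplusA' a b c bc s : oplus A b c = Some bc -> oplus A a bc = Some s ->
  exists ab, oplus A a b = Some ab /\ oplus A ab c = Some s.
Proof.
move=> /oplusC h1 /oplusC h2; have [ab [/oplusC g1 /oplusC g2]] := oplusA h1 h2.
by exists ab.
Qed.

Lemma oplus_le a b c : oplus A a b = Some c -> a <= c.
Proof. by move=> h; apply/(ea_le A); exists b. Qed.

Lemma oplus_ler a b c : oplus A a b = Some c -> b <= c.
Proof. by move=> /oplusC/oplus_le. Qed.

Lemma oplus_compl_eq a b c : oplus A a b = Some c -> oplus A b c^c = Some a^c.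
Proof.
move=> h; have [e [h1 h2]] := oplusA h (oplus_compl c).
by rewrite h1; congr Some; apply/(ocomplP A).
Qed.

Lemma oplusI a b b' c : oplus A a b = Some c -> oplus A a b' = Some c -> b = b'.
Proof.
have aux u : oplus A a u = Some c -> exists2 v, oplus A c^c a = Some v & u = v^c.
  move=> /oplus_compl_eq h; have := oplus_compl a^c; rewrite ocomplK.
  move=> h2; have [v [h3 h4]] := oplusA h h2; exists v => //.
  by apply/(ocomplP A)/oplusC.
by move=> /aux[v h ->] /aux[v' + ->]; rewrite h => -[->].
Qed.

Lemma oplus_perp a b : (exists c, oplus A a b = Some c) <-> b <= a^c.
Proof.
split=> [[c /oplus_compl_eq]|/(ea_le A)[c h]]; first exact: oplus_le.
have := oplus_compl a => h'; have [ab [h1 _]] := oplusA' h h'.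
by exists ab.
Qed.

Lemma oplus_def_le a b c (x : E) : oplus A a b = Some c -> x <= b ->
  exists y, oplus A a x = Some y.
Proof.
move=> h xb; apply/oplus_perp; apply: le_trans xb _; apply/oplus_perp.
by exists c.
Qed.

(* odiff a b = b (-) a and oadd = (+) where these are defined. *)
Definition oadd a b := odflt \bot (oplus A a b).
Definition odiff a b := xget \bot [set c | oplus A a c = Some b]%classic.

Lemma odiffP a b : a <= b -> oplus A a (odiff a b) = Some b.
Proof.
move=> /(ea_le A)[c h]; rewrite /odiff.
by case: xgetP => [x _ //|/(_ c)].
Qed.

Lemma odiff_eq a b c : oplus A a c = Some b -> odiff a b = c.
Proof. by move=> h; apply: (oplusI (odiffP (oplus_le h)) h). Qed.

Section Measure.
Context {d' : Order.disp_t} {P : tbPOrderType d'} (f : P -> E).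
Hypothesis f_homo : {homo f : x y / x <= y}.
Hypothesis f0 : f \bot = \bot.
Hypothesis f1 : f \top = \top.

Fixpoint meas (q : pred P) (C : seq P) : E :=
  if C is c :: C' then
    if q c then oadd (odiff (f c) (f (head \top C'))) (meas q C')
    else meas q C'
  else \bot.

Lemma meas_eq q q' C : {in C, q =1 q'} -> meas q C = meas q' C.
Proof.
elim: C => //= c C IH h; rewrite h ?mem_head // IH // => x xC.
by apply: h; rewrite inE xC orbT.
Qed.

Lemma head_le (c : P) C : path <=%O c C -> f c <= f (head \top C).
Proof. by case: C => [|c' C] /=; rewrite ?f1 ?lex1 // => /andP[/f_homo]. Qed.

Lemma dif_compl a b : a <= b -> oplus A (odiff a b) b^c = Some a^c.
Proof. by move=> /odiffP/oplus_compl_eq. Qed.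

Lemma measT C : sorted <=%O C ->
  meas predT C = (f (head \top C))^c.
Proof.
elim: C => [|c C IH] /= sC; first by rewrite f1 ocompl1.
rewrite IH ?(path_sorted sC) // /oadd.
by rewrite dif_compl ?head_le.
Qed.

Lemma meas_add q q' C : sorted <=%O C -> {in C, forall x, ~~ (q x && q' x)} ->
  oplus A (meas q C) (meas q' C) = Some (meas (predU q q') C).
Proof.
elim: C q q' => [|c C IH] q q' /= sC dis; first exact: oplus0.
have sC' := path_sorted sC.
have disC : {in C, forall x, ~~ (q x && q' x)}.
  by move=> x xC; apply: dis; rewrite inE xC orbT.
have := IH q q' sC' disC; set x := meas q C; set y := meas q' C.
set z := meas _ C => xyz.
have zT : z <= (f (head \top C))^c.
  rewrite -measT //; apply: (@oplus_le _ (meas (predC (predU q q')) C)).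
  rewrite IH //; last by move=> u _ /=; rewrite andbN.
  by congr Some; apply: meas_eq => u _ /=; rewrite orbN.
have dd := dif_compl (head_le sC); set D := odiff _ _ in dd *.
have [w dz] := oplus_def_le dd zT.
have := dis c (mem_head _ _); rewrite /oadd dz /=.
have [qc|_] := boolP (q c); have [q'c|_] := boolP (q' c) => //= _.
  by have [v [h1 h2]] := oplusA' xyz dz; rewrite h1 /= h2.
have [v [h1 h2]] := oplusA' (oplusC xyz) dz.
by rewrite h1 /=; apply: oplusC.
Qed.

Lemma meas_le (q q' : pred P) C : sorted <=%O C -> {in C, forall x, q x -> q' x} ->
  meas q C <= meas q' C.
Proof.
move=> sC h; apply: (@oplus_le _ (meas (predD q' q) C)).
rewrite meas_add //; last by move=> x _ /=; case: (q x).
congr Some; apply: meas_eq => x xC /=.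
by case qx: (q x) => //=; rewrite h.
Qed.

Fixpoint kval (s : seq P) : E :=
  if s is a :: s' then odiff (kval s') (f a)^c else \bot.

Lemma meas_pred0 q C : {in C, q =1 pred0} -> meas q C = \bot.
Proof.
elim: C => //= c C IH h; rewrite h ?mem_head // IH // => x xC.
by apply: h; rewrite inE xC orbT.
Qed.

Lemma kval_meas s C : sorted <%O s -> sorted <%O C -> {subset s <= C} ->
  meas (par s) C = kval s.
Proof.
elim: C s => [|c C IH] [|a s] // ss sC sub.
- by have := sub a (mem_head _ _).
- by rewrite meas_pred0.
have sC1 : sorted <=%O (c :: C) by apply: sub_sorted sC; apply: ltW.
have cC x : x \in C -> c < x.
  by move: sC; rewrite /= lt_path_sortedE => /andP[/allP h _] /h.
have as' x : x \in s -> a < x.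
  by move: ss; rewrite /= lt_path_sortedE => /andP[/allP h _] /h.
have sub' : {subset s <= C}.
  move=> x xs; have := sub x; rewrite !inE xs orbT => /(_ isT)/orP[/eqP xc|//].
  have := sub a (mem_head _ _); rewrite inE => /orP[/eqP ac|/cC].
    by have := as' _ xs; rewrite ac xc ltxx.
  by rewrite -xc => /lt_trans/(_ (as' _ xs)); rewrite ltxx.
have par_s_c : par s c = false.
  rewrite /par (@eq_in_count _ _ pred0) ?count_pred0 // => x /sub'/cC.
  by move=> /lt_geF ->.
have IHs := IH s (path_sorted ss) (path_sorted sC) sub'.
have := sub a (mem_head _ _); rewrite inE => /orP[/eqP ac|aC].
  subst a; have par_c : par (c :: s) c.
    by move: par_s_c; rewrite /par /= lexx /= => ->.
  have e : oplus A (meas (par s) (c :: C)) (meas (par (c :: s)) (c :: C))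
           = Some (f c)^c.
    rewrite meas_add // -?(measT sC1).
      congr Some; apply: meas_eq => x; rewrite inE /= => /orP[/eqP->|/cC cx].
        by rewrite par_c orbT.
      by rewrite /par /= (ltW cx) /=; case: odd.
    move=> x; rewrite inE => /orP[/eqP->|/cC cx]; first by rewrite par_s_c.
    by rewrite /par /= (ltW cx) /=; case: odd.
  have e2 : meas (par s) (c :: C) = kval s by rewrite /= par_s_c.
  by rewrite e2 in e; apply/esym/odiff_eq.
have sub2 : {subset a :: s <= C}.
  by move=> x; rewrite inE => /orP[/eqP->|/sub'].
rewrite -(IH (a :: s) ss (path_sorted sC) sub2) /=.
have -> // : par (a :: s) c = false.
rewrite /par (@eq_in_count _ _ pred0) ?count_pred0 // => x /sub2/cC.
by move=> /lt_geF ->.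
Qed.

Lemma kval_cons2 (a b : P) s : sorted <%O [:: a, b & s] ->
  exists u, oplus A (f a) u = Some (f b)
    /\ oplus A u (kval s) = Some (kval [:: a, b & s]).
Proof.
move=> ss; have /andP[ab sb] : (a < b) && path <%O b s := ss.
exists (odiff (f a) (f b)); split; first exact/odiffP/f_homo/ltW.
have sle : sorted <=%O [:: a, b & s] by apply: sub_sorted ss; apply: ltW.
rewrite -(kval_meas ss ss) //.
have -> : kval s = meas (par s) s by rewrite kval_meas // (path_sorted sb).
have bs x : x \in s -> b < x.
  by move: sb; rewrite lt_path_sortedE => /andP[/allP h _] /h.
have e0 (x : P) : x <= b -> count (fun y => y <= x) s = 0%N.
  move=> xb; rewrite (@eq_in_count _ _ pred0) ?count_pred0 // => y /bs.
  by move=> /(le_lt_trans xb)/lt_geF ->.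
have pa : par [:: a, b & s] a.
  by rewrite /par /= lexx (lt_geF ab) e0 // ltW.
have pb : par [:: a, b & s] b = false.
  by rewrite /par /= lexx (ltW ab) e0.
have ps : {in s, par s =1 par [:: a, b & s]}.
  move=> x /bs bx; rewrite /par /= (ltW bx) (ltW (lt_trans ab bx)) /=.
  by rewrite negbK.
rewrite [X in Some X]/= pa pb /oadd (meas_eq ps).
have := dif_compl (f_homo (ltW ab)).
move=> /oplus_def_le; move=> /(_ (meas (par [:: a, b & s]) s)).
case=> [|y ->] //; rewrite -[f b]/(f (head \top (b :: s))) -measT //; last first.
  by case/andP: sle.
have -> : meas (par [:: a, b & s]) s
   = meas (par [:: a, b & s]) (b :: s) by rewrite /= pb.
by apply: meas_le => //; case/andP: sle.
Qed.

Lemma kcommon (S T : kalmbach P) : kcmp S T ->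
  exists C, [/\ sorted <%O C, {subset kseq S <= C} & {subset kseq T <= C}].
Proof.
move=> c; exists (undup (sort <=%O (S ++ T))).
have mem x : (x \in undup (sort <=%O (S ++ T))) = (x \in kseq S) || (x \in kseq T).
  by rewrite mem_undup mem_sort mem_cat.
split; [|by move=> x xS; rewrite mem xS|by move=> x xT; rewrite mem xT orbT].
rewrite lt_sorted_uniq_le undup_uniq /=.
apply: (subseq_sorted le_trans (undup_subseq _)).
suff tot : {in kseq S ++ kseq T &, total <=%O}.
  by apply: (sort_sorted_in tot); apply/allP.
move=> x y; rewrite !mem_cat => /orP[xS|xT] /orP[yS|yT].
- exact: kcmpS xS yS.
- exact: c.
- exact: (kcmpC c).
- exact: kcmpS xT yT.
Qed.

Lemma kval_homo : {homo (fun S : kalmbach P => kval S) : S T / S <= T}.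
Proof.
move=> S T /kle_def[c h]; have [C [sC SC TC]] := kcommon c.
rewrite -(kval_meas (kseq_sorted S) sC SC) -(kval_meas (kseq_sorted T) sC TC).
by apply: meas_le => [|x _]; [apply: sub_sorted sC; apply: ltW|apply: h].
Qed.

Lemma kval_add (S T U : kalmbach P) : S <= kperp T -> is_join S T U ->
  oplus A (kval S) (kval T) = Some (kval U).
Proof.
move=> ST jU; have [pU mU] := kjoin_par ST jU.
have [c dis] := kperp_dis ST; have [C [sC SC TC]] := kcommon c.
have UC : {subset kseq U <= C} by move=> x /mU/orP[/SC|/TC].
rewrite -(kval_meas (kseq_sorted S) sC SC) -(kval_meas (kseq_sorted T) sC TC).
rewrite -(kval_meas (kseq_sorted U) sC UC) meas_add.
- congr Some; apply: meas_eq => x _ /=; rewrite pU.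
  by case Sx: (par S x) => //=; rewrite (negPf (dis _ Sx)).
- by apply: sub_sorted sC; apply: ltW.
- by move=> x _; apply/negP => /andP[/dis/negPf->].
Qed.

Lemma kval_eta (a : P) : kval (keta a) = f a.
Proof.
have e (s : seq P) : s = keta a -> kval (keta a) = kval s by move=> ->.
have [->|a0] := eqVneq a \bot; first by rewrite bfun0 f0.
rewrite (e [:: \bot; a]).
  rewrite /= (@odiff_eq \bot (f a)^c (f a)^c) ?oplus0l // f0 ocompl0.
  by apply/odiff_eq/oplusC/oplus_compl.
rewrite /= /odd_part /= inE eq_sym (negPf a0) /= eqxx (negPf a0) /=.
by rewrite eq_sym (negPf a0) eqxx.
Qed.

Lemma kval_bpos : exists2 g : bpos_hom (kalmbach P) E,
  (forall S, g S = kval S) & forall a : P, g (keta a) = f a.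
Proof.
have k1 : kval (\top : kalmbach P) = \top by rewrite -f1 -kval_eta bfun1.
by exists (@BposHom _ _ (kalmbach P) E (fun S => kval S) kval_homo erefl k1)
  => // a; apply: kval_eta.
Qed.

End Measure.

(* Two additive maps on K(P) agreeing on the chains [0 < a] are equal. *)
Lemma kalmbach_add_uniq d' (P : tbPOrderType d')
    (g h : bpos_hom (kalmbach P) E) :
  (forall S T U, S <= kperp T -> is_join S T U ->
     oplus A (g S) (g T) = Some (g U)) ->
  (forall S T U, S <= kperp T -> is_join S T U ->
     oplus A (h S) (h T) = Some (h U)) ->
  (forall a : P, g (keta a) = h (keta a)) -> forall S, g S = h S.
Proof.
move=> ga ha e; apply: kalmbach_ind_eta => [|S a b _ Sa j|S T U ST j gS gT].
- by rewrite !bfun0.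
- have := ga _ _ _ Sa j; have := ha _ _ _ Sa j; rewrite -!e => /oplusC h1 /oplusC.
  by move=> /oplusI; apply.
- by have := ga _ _ _ ST j; have := ha _ _ _ ST j; rewrite gS gT => -> [].
Qed.

End EffectAlgebraTheory.

Section OmpEffectAlgebra.
Context {d : Order.disp_t} {Q : tbPOrderType d} (O : orthomodular Q).

Definition omp_oplus (a b : Q) : option Q :=
  if a <= perp O b then Some (xget \bot [set c | is_join a b c]%classic)
  else None.

Lemma omp_oplusP a b c :
  omp_oplus a b = Some c <-> a <= perp O b /\ is_join a b c.
Proof.
have uniq x y : is_join a b x -> is_join a b y -> x = y.
  by move=> h1 h2; apply/le_anti; rewrite h1 -h2 lexx h2 -h1 lexx.
rewrite /omp_oplus; case: ifP => [ab|]; last by split=> // -[].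
have [e je] := perp_join ab.
have -> : xget \bot [set c | is_join a b c]%classic = e.
  by case: xgetP => [x _ /uniq/(_ je)//|/(_ e)].
by split=> [[<-]//|[_ /(uniq _ _ je) ->]].
Qed.

Lemma perp_top : perp O \top = \bot.
Proof. by apply/le_anti; rewrite le0x andbT (perp_le O) perpK lex1. Qed.

Lemma perp_sym a b : (a <= perp O b) = (b <= perp O a).
Proof. by rewrite (perp_le O) perpK. Qed.

Lemma is_joinC a b (c : Q) : is_join a b c -> is_join b a c.
Proof. by move=> h x; rewrite h andbC. Qed.

Lemma is_join_ub a b (c : Q) : is_join a b c -> a <= c /\ b <= c.
Proof. by move=> h; have := h c; rewrite lexx => /esym/andP. Qed.

Fact omp_le a b : a <= b <-> exists c, omp_oplus a c = Some b.
Proof.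
split=> [ab|[c /omp_oplusP[_ /is_join_ub[]]]//].
have [e je] := @perp_join _ _ O a (perp O b) (etrans (congr1 _ (perpK O b)) ab).
have ce : is_meet (perp O a) b (perp O e).
  move=> x; rewrite perp_sym je perp_sym; congr andb.
  by rewrite perp_sym perpK.
have ac : a <= perp O (perp O e) by rewrite perpK; case: (is_join_ub je).
have [h jh] := perp_join ac; exists (perp O e).
apply/omp_oplusP; split=> //.
have hb : h <= b by rewrite jh ab /=; have := ce (perp O e); rewrite lexx => /esym/andP[].
suff -> : b = h by [].
have hb' : perp O b <= perp O h by rewrite -(perp_le O).
have [k jk] := perp_join hb'.
have mk := perp_omod hb' jk.
rewrite perpK in mk.
suff k1 : k = \top.
  by apply/le_anti; rewrite hb andbT mk lexx k1 lex1.
have h2 : perp O k <= perp O e.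
  rewrite ce -!(perp_le O); have [k1 k2] := is_join_ub jk.
  have [h1' _] := is_join_ub jh; rewrite (le_trans h1' k2) /=.
  by rewrite (perp_le O) perpK.
have h3 : perp O k <= e.
  rewrite (perp_le O) perpK; apply: le_trans (proj2 (is_join_ub jk)).
  exact: (proj2 (is_join_ub jh)).
have := perp_meet O e (perp O k); rewrite h3 h2 /= lex0 => /eqP k0.
by rewrite -[k](perpK O) k0 -perp_top perpK.
Qed.

Fact omp_plusC a b c : omp_oplus a b = Some c -> omp_oplus b a = Some c.
Proof. by move=> /omp_oplusP[h /is_joinC j]; apply/omp_oplusP; rewrite perp_sym. Qed.

Fact omp_plus0 a : omp_oplus a \bot = Some a.
Proof.
apply/omp_oplusP; rewrite perp_sym le0x; split=> // x.
by rewrite le0x andbT.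
Qed.

Fact omp_plusA a b c ab s : omp_oplus a b = Some ab -> omp_oplus ab c = Some s ->
  exists bc, omp_oplus b c = Some bc /\ omp_oplus a bc = Some s.
Proof.
move=> /omp_oplusP[h1 j1] /omp_oplusP[h2 j2].
have [aab bab] := is_join_ub j1.
have bc := le_trans bab h2; have [e je] := perp_join bc.
exists e; split; first exact/omp_oplusP.
apply/omp_oplusP; split=> [|x]; last by rewrite j2 j1 je andbA.
by rewrite perp_sym je perp_sym h1 perp_sym (le_trans aab h2).
Qed.

Fact omp_complP a b : omp_oplus a b = Some \top <-> b = perp O a.
Proof.
split=> [/omp_oplusP[h j]|->].
  have m := perp_omod h j; apply/le_anti; rewrite m lexx lex1 /=.
  by rewrite perp_sym h.
apply/omp_oplusP; rewrite perpK; split=> // x.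
rewrite le1x; apply/eqP/andP => [->|[ax a'x]]; first by rewrite !lex1.
have := perp_meet O a (perp O x).
rewrite [perp O x <= a](perp_le O) perpK a'x -(perp_le O) ax lex0 => /eqP x0.
by rewrite -[x](perpK O) x0 -perp_top perpK.
Qed.

Fact omp_plus1 a s : omp_oplus a \top = Some s -> a = \bot.
Proof. by move=> /omp_oplusP[]; rewrite perp_top lex0 => /eqP. Qed.

Definition omp_ea : effect_algebra Q :=
  EffectAlgebra omp_le omp_plusC omp_plus0 omp_plusA omp_complP omp_plus1.

Lemma omp_eaP a b c :
  oplus omp_ea a b = Some c <-> a <= perp O b /\ is_join a b c.
Proof. exact: omp_oplusP. Qed.
End OmpEffectAlgebra.

Lemma omp_hom_add d d' (P : tbPOrderType d) (Q : tbPOrderType d')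
    (OP : orthomodular P) (O : orthomodular Q) (g : omp_hom OP O) :
  forall S T U, S <= perp OP T -> is_join S T U ->
  oplus (omp_ea O) (g S) (g T) = Some (g U).
Proof.
move=> S T U ST jU; apply/omp_eaP; split; first exact: ofun_perp.
exact: ofun_join ST jU.
Qed.

(* K is left adjoint to the forgetful functor, with unit keta. *)
Theorem kalmbach_free d d' (P : tbPOrderType d) (Q : tbPOrderType d')
    (O : orthomodular Q) (f : bpos_hom P Q) :
  exists g : omp_hom (kalmbach_omp P) O, forall a, g (keta a) = f a.
Proof.
have [g gE ge] := kval_bpos (omp_ea O) (bfun_homo f) (bfun0 f) (bfun1 f).
have ga S T U : S <= kperp T -> is_join S T U ->
    oplus (omp_ea O) (g S) (g T) = Some (g U).
  move=> ST jU; rewrite !gE.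
  by apply: (kval_add (omp_ea O) (bfun_homo f) (bfun1 f) ST jU).
have g1 S T : S <= perp (kalmbach_omp P) T -> g S <= perp O (g T).
  by move=> ST; have [U jU] := kperp_join ST; case/omp_eaP: (ga _ _ _ ST jU).
have g2 S T U : S <= perp (kalmbach_omp P) T -> is_join S T U ->
    is_join (g S) (g T) (g U).
  by move=> ST jU; case/omp_eaP: (ga _ _ _ ST jU).
by exists (OmpHom g1 g2).
Qed.

Theorem kalmbach_free_uniq d d' (P : tbPOrderType d) (Q : tbPOrderType d')
    (O : orthomodular Q) (g h : omp_hom (kalmbach_omp P) O) :
  (forall a, g (keta a) = h (keta a)) -> forall S, g S = h S.
Proof.
move=> e; apply: (@kalmbach_add_uniq _ _ (omp_ea O)) => //.
- by move=> S T U; apply: (omp_hom_add g).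
- by move=> S T U; apply: (omp_hom_add h).
Qed.

(* The OMP morphism K(P) -> Q adjoint to f : P -> U(Q). *)
Definition kext d d' (P : tbPOrderType d) (Q : tbPOrderType d')
    (O : orthomodular Q) (f : bpos_hom P Q) : omp_hom (kalmbach_omp P) O :=
  sval (cid (kalmbach_free O f)).

Lemma kext_eta d d' (P : tbPOrderType d) (Q : tbPOrderType d')
    (O : orthomodular Q) (f : bpos_hom P Q) a : kext O f (keta a) = f a.
Proof. by rewrite /kext; case: cid. Qed.

(* The counit at Q, and the multiplication U(counit at K(P)) of the monad. *)
Definition kcounit d (Q : tbPOrderType d) (O : orthomodular Q) :
  omp_hom (kalmbach_omp Q) O := kext O (bpos_id Q).

Definition kmu d (P : tbPOrderType d) :
  bpos_hom (kalmbach (kalmbach P)) (kalmbach P) := kcounit (kalmbach_omp P).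

Section KalmbachMap.
Context {d d' : Order.disp_t} {P : tbPOrderType d} {Q : tbPOrderType d'}.
Variable f : bpos_hom P Q.

Fact kmap_subproof (S : kalmbach P) : sorted <=%O [seq f x | x <- S].
Proof.
apply: (homo_sorted (bfun_homo f)).
by apply: sub_sorted (kseq_sorted S); apply: ltW.
Qed.

Fact kmap_even (S : kalmbach P) : odd (size [seq f x | x <- S]) = false.
Proof. by rewrite size_map kseq_even. Qed.

Definition kmap_fun (S : kalmbach P) : kalmbach Q :=
  kbuild (kmap_subproof S) (kmap_even S).

Lemma par_kmap S x : par (kmap_fun S) x = odd (count (fun y => f y <= x) S).
Proof. by rewrite par_kbuild /par count_map. Qed.

Lemma kmap_eta a : kmap_fun (keta a) = keta (f a).
Proof.
apply: kpar_inj => x.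
by rewrite par_kmap odd_count_odd_part par_keta /= bfun0 le0x addn0; case: (_ <= _).
Qed.

Lemma kmap_kext S :
  kmap_fun S = kext (kalmbach_omp Q) (bpos_comp keta f) S.
Proof.
set g := kext _ _; have ge a : g (keta a) = keta (f a) by rewrite kext_eta.
have gp S1 S2 U x : S1 <= kperp S2 -> is_join S1 S2 U ->
    par (g U) x = par (g S1) x (+) par (g S2) x.
  move=> h jU.
  by have [->] := kjoin_par (ofun_perp g h) (ofun_join g h jU).
apply/esym/kpar_inj => x; rewrite par_kmap.
elim/kalmbach_ind_eta: S => [|S a b Sab Sa j|S T U ST j hS hT].
- by rewrite bfun0.
- have := gp _ _ _ x Sa j; rewrite !ge !par_keta Sab /= addn0 oddD.
  by case: (par _ x); case: (f a <= x); case: (f b <= x).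
- by rewrite (gp _ _ _ x ST j) hS hT (kjoin_count _ ST j).
Qed.

Fact kmap_homo : {homo kmap_fun : S T / S <= T}.
Proof. by rewrite (funext kmap_kext); apply: bfun_homo. Qed.

Fact kmap0 : kmap_fun \bot = \bot.
Proof. exact: etrans (kmap_kext _) (bfun0 _). Qed.

Fact kmap1 : kmap_fun \top = \top.
Proof. exact: etrans (kmap_kext _) (bfun1 _). Qed.

Definition kmap_bpos : bpos_hom (kalmbach P) (kalmbach Q) :=
  BposHom kmap_homo kmap0 kmap1.

Fact kmap_perp S T : S <= perp (kalmbach_omp P) T ->
  kmap_bpos S <= perp (kalmbach_omp Q) (kmap_bpos T).
Proof. by rewrite /= !kmap_kext => /(ofun_perp (kext _ _)). Qed.

Fact kmap_join S T U : S <= perp (kalmbach_omp P) T -> is_join S T U ->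
  is_join (kmap_bpos S) (kmap_bpos T) (kmap_bpos U).
Proof. by rewrite /= !kmap_kext; apply: (ofun_join (kext _ _)). Qed.

(* K(f)(S) is the symmetric difference of the {f(s)}, for s ranging over S. *)
Definition kmap : omp_hom (kalmbach_omp P) (kalmbach_omp Q) :=
  OmpHom kmap_perp kmap_join.
End KalmbachMap.

(* Eilenberg-Moore algebras for the monad T = U K. *)
Record kalgebra := Kalgebra {
  kdisp : Order.disp_t;
  kcar :> tbPOrderType kdisp;
  kstr : bpos_hom (kalmbach kcar) kcar;
  kstr_eta : forall a, kstr (keta a) = a;
  kstr_mu : forall S : kalmbach (kalmbach kcar),
    kstr (kmap kstr S) = kstr (kmu kcar S) }.

(* x = (a_2 (-) a_1) (+) ... (+) (a_2n (-) a_2n-1), for s = [a_1; ...; a_2n] *)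
Fixpoint altsum d (E : tbPOrderType d) (A : effect_algebra E) (s : seq E)
    (x : E) : Prop :=
  match s with
  | [::] => x = \bot
  | a :: b :: s' => exists u v,
      [/\ oplus A a u = Some b, altsum A s' v & oplus A u v = Some x]
  | [:: _] => False
  end.

(* The isomorphism between effect algebras and algebras for T is the identity
   on the underlying bounded posets. *)
Definition corresponds (X : kalgebra) (A : effect_algebra X) :=
  forall S : kalmbach X, altsum A S (kstr X S).

Record effect_monoid_law d (E : tbPOrderType d) (A : effect_algebra E)
    (mul : E -> E -> E) : Prop := EffectMonoidLaw {
  emulA : associative mul;
  emul1 : right_id \top mul;
  e1mul : left_id \top mul;
  emulDr : forall x y z s, oplus A y z = Some s ->
    oplus A (mul x y) (mul x z) = Some (mul x s);
  emulDl : forall x y z s, oplus A y z = Some s ->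
    oplus A (mul y x) (mul z x) = Some (mul s x) }.

(* Monoids in the full subcategory of the algebras for T whose underlying
   bounded poset is omega-complete; the tensor product is that of the
   corresponding effect algebras. *)
Record kmonoid := Kmonoid {
  kalg :> kalgebra;
  komega : omega_complete kalg;
  kea : effect_algebra kalg;
  kcorr : corresponds kea;
  kmul : kalg -> kalg -> kalg;
  kmul_law : effect_monoid_law kea kmul }.

Record is_khom (M N : kmonoid) (f : M -> N) : Prop := IsKhom {
  khom_top : f \top = \top;
  khom_add : forall a b c, oplus (kea M) a b = Some c ->
    oplus (kea N) (f a) (f b) = Some (f c);
  khom_mul : forall a b, f (kmul a b) = kmul (f a) (f b) }.

Definition kiso (M N : kmonoid) := exists (f : M -> N) (g : N -> M),
  [/\ is_khom f, is_khom g, cancel f g & cancel g f].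

Definition is_initial (M : kmonoid) := forall N : kmonoid,
  exists2 f : M -> N, is_khom f & forall g : M -> N, is_khom g -> f =1 g.

Definition is_final (M : kmonoid) := forall N : kmonoid,
  exists2 f : N -> M, is_khom f & forall g : N -> M, is_khom g -> f =1 g.

Section AlgebraOfEffectAlgebra.
Context {d : Order.disp_t} {E : tbPOrderType d} (A : effect_algebra E).

Fact ea_str_ex : exists2 g : bpos_hom (kalmbach E) E,
  (forall S, g S = kval A idfun S) & forall a : E, g (keta a) = a.
Proof. exact: (@kval_bpos _ _ A _ _ idfun). Qed.

Definition ea_str : bpos_hom (kalmbach E) E := s2val (cid2 ea_str_ex).

Lemma ea_strE S : ea_str S = kval A idfun S.
Proof. by rewrite /ea_str; case: cid2. Qed.

Lemma ea_str_eta a : ea_str (keta a) = a.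
Proof. by rewrite /ea_str; case: cid2. Qed.

Lemma ea_str_add (S T U : kalmbach E) : S <= kperp T -> is_join S T U ->
  oplus A (ea_str S) (ea_str T) = Some (ea_str U).
Proof. by rewrite !ea_strE; apply: (@kval_add _ _ A _ _ idfun). Qed.

Lemma kmu_eta (S : kalmbach E) : kmu E (keta S) = S.
Proof. exact: kext_eta. Qed.

Lemma ea_str_mu (S : kalmbach (kalmbach E)) :
  ea_str (kmap ea_str S) = ea_str (kmu E S).
Proof.
apply: (@kalmbach_add_uniq _ _ A _ _ (bpos_comp ea_str (kmap ea_str))
                                     (bpos_comp ea_str (kmu E))) => /=.
- move=> S1 S2 U h j; apply: ea_str_add; first exact: (ofun_perp (kmap ea_str)).
  exact: (ofun_join (kmap ea_str) h j).
- move=> S1 S2 U h j; apply: ea_str_add.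
    exact: (ofun_perp (kcounit (kalmbach_omp E))).
  exact: (ofun_join (kcounit (kalmbach_omp E)) h j).
- by move=> a; rewrite kmu_eta kmap_eta ea_str_eta.
Qed.

Definition ea_kalgebra : kalgebra := Kalgebra ea_str_eta ea_str_mu.

Lemma ea_corr : @corresponds ea_kalgebra A.
Proof.
move=> S /=; rewrite ea_strE.
have [n] := ubnP (size S); have := kseq_sorted S; have := kseq_even S.
elim: n (kseq S) => // n IH [|a [|b s]] //= es ss sn.
have [u [h1 h2]] := @kval_cons2 _ _ A _ _ idfun (fun _ _ => id) erefl _ _ _ ss.
exists u, (kval A idfun s); split=> //; apply: IH.
- by rewrite negbK in es.
- exact: path_sorted (path_sorted (ss : sorted _ [:: a, b & s])).
- exact: ltnW.
Qed.
End AlgebraOfEffectAlgebra.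

Section Product.
Context {d1 d2 : Order.disp_t}.
Context {E1 : tbPOrderType d1} {E2 : tbPOrderType d2}.

Lemma prod_omega : omega_complete E1 -> omega_complete E2 ->
  omega_complete (E1 *p E2)%type.
Proof.
move=> h1 h2 a ha.
have [s1 [u1 l1]] := h1 (fun n => (a n).1) (fun n => proj1 (andP (ha n))).
have [s2 [u2 l2]] := h2 (fun n => (a n).2) (fun n => proj2 (andP (ha n))).
exists (s1, s2); split=> [_ [n _ <-]|[x y] xy].
  by apply/andP; split; [apply: u1|apply: u2]; exists n.
apply/andP; split; [apply: l1|apply: l2] => _ [n _ <-].
  by have /andP[] := xy _ (ex_intro2 _ _ n I erefl).
by have /andP[] := xy _ (ex_intro2 _ _ n I erefl).
Qed.

Context (A1 : effect_algebra E1) (A2 : effect_algebra E2).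
Local Notation E := (E1 *p E2)%type.

Definition prod_oplus (a b : E) : option E :=
  match oplus A1 a.1 b.1, oplus A2 a.2 b.2 with
  | Some x, Some y => Some (x, y)
  | _, _ => None
  end.

Definition prod_ocompl (a : E) : E := (ocompl A1 a.1, ocompl A2 a.2).

Lemma prod_oplusP (a b c : E) : prod_oplus a b = Some c <->
  oplus A1 a.1 b.1 = Some c.1 /\ oplus A2 a.2 b.2 = Some c.2.
Proof.
rewrite /prod_oplus; case: c => c1 c2 /=.
case: (oplus A1 _ _) => [x|]; last by split=> [|[]].
case: (oplus A2 _ _) => [y|]; last by split=> [|[]].
by split=> [[-> ->]|[[->] [->]]].
Qed.

Fact prod_ea_le (a b : E) : a <= b <-> exists c, prod_oplus a c = Some b.
Proof.
split=> [/andP[/(ea_le A1)[x hx] /(ea_le A2)[y hy]]|[c /prod_oplusP[h1 h2]]].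
  by exists (x, y); apply/prod_oplusP.
by apply/andP; split; [apply: oplus_le h1|apply: oplus_le h2].
Qed.

Fact prod_oplusC a b c : prod_oplus a b = Some c -> prod_oplus b a = Some c.
Proof. by move=> /prod_oplusP[/oplusC h1 /oplusC h2]; apply/prod_oplusP. Qed.

Fact prod_oplus0 a : prod_oplus a \bot = Some a.
Proof. by apply/prod_oplusP; rewrite !oplus0. Qed.

Fact prod_oplusA a b c ab s :
  prod_oplus a b = Some ab -> prod_oplus ab c = Some s ->
  exists bc, prod_oplus b c = Some bc /\ prod_oplus a bc = Some s.
Proof.
move=> /prod_oplusP[h1 h2] /prod_oplusP[/(oplusA h1)[x [x1 x2]] /(oplusA h2)[y [y1 y2]]].
by exists (x, y); split; apply/prod_oplusP.
Qed.

Fact prod_ocomplP a b : prod_oplus a b = Some \top <-> b = prod_ocompl a.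
Proof.
case: b => b1 b2; split=> [/prod_oplusP[/ocomplP/= -> /ocomplP/= ->]//|[-> ->]].
by apply/prod_oplusP; rewrite !oplus_compl.
Qed.

Fact prod_oplus1 a s : prod_oplus a \top = Some s -> a = \bot.
Proof. by case: a => a1 a2 /prod_oplusP[/oplus1/= -> /oplus1/= ->]. Qed.

Definition prod_ea : effect_algebra E :=
  EffectAlgebra prod_ea_le prod_oplusC prod_oplus0 prod_oplusA
    prod_ocomplP prod_oplus1.

Definition prod_mul (mul1 : E1 -> E1 -> E1) (mul2 : E2 -> E2 -> E2)
  (a b : E) : E := (mul1 a.1 b.1, mul2 a.2 b.2).

Lemma prod_mul_law mul1 mul2 :
  effect_monoid_law A1 mul1 -> effect_monoid_law A2 mul2 ->
  effect_monoid_law prod_ea (prod_mul mul1 mul2).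
Proof.
move=> [a1 b1 c1 d1' e1] [a2 b2 c2 d2' e2]; split.
- by move=> x y z; congr pair; [apply: a1|apply: a2].
- by move=> [x y]; congr pair; [apply: b1|apply: b2].
- by move=> [x y]; congr pair; [apply: c1|apply: c2].
- move=> x y z s /prod_oplusP[h1 h2]; apply/prod_oplusP.
  by split; [apply: d1'|apply: d2'].
- move=> x y z s /prod_oplusP[h1 h2]; apply/prod_oplusP.
  by split; [apply: e1|apply: e2].
Qed.
End Product.

(* Cartesian product, with pointwise operations. *)
Definition kprod (M1 M2 : kmonoid) : kmonoid :=
  let A := prod_ea (kea M1) (kea M2) in
  @Kmonoid (ea_kalgebra A) (prod_omega (@komega M1) (@komega M2))
    A (@ea_corr _ _ A) (prod_mul (@kmul M1) (@kmul M2))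
    (prod_mul_law (kmul_law M1) (kmul_law M2)).

Definition irreducible (M : kmonoid) := forall M1 M2 : kmonoid,
  kiso M (kprod M1 M2) -> is_final M1 \/ is_final M2.

Section UnitInterval.
Import GRing.Theory Num.Theory.
Local Open Scope ring_scope.
Variable R : realType.

Definition unit_interval := {i01 R}.

HB.instance Definition _ := Order.POrder.on unit_interval.

Local Notation I := unit_interval.

Fact ui_le0 (a : I) : (0%:i01 : I) <= a.
Proof. by change (0 <= a%:num :> R). Qed.

Fact ui_le1 (a : I) : a <= (1%:i01 : I).
Proof. by change (a%:num <= 1 :> R). Qed.

HB.instance Definition _ := Order.hasBottom.Build ring_display I ui_le0.
HB.instance Definition _ := Order.hasTop.Build ring_display I ui_le1.

(* a + b if it lies in [0, 1], undefined otherwise *)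
Definition ui_oplus (a b : I) : option I := insub (a%:num + b%:num).

Definition ui_ocompl (a : I) : I := (1 - a%:num)%:i01.

Definition ui_mul (a b : I) : I := (a%:num * b%:num)%:i01.

Lemma ui_leE (a b : I) : (a <= b) = (a%:num <= b%:num).
Proof. by []. Qed.

Lemma ui_bot : (\bot%O : I)%:num = 0 :> R.
Proof. by []. Qed.

Lemma ui_top : (\top%O : I)%:num = 1 :> R.
Proof. by []. Qed.

Lemma ui_inj (a b : I) : a%:num = b%:num -> a = b.
Proof. exact: val_inj. Qed.

Lemma ui_of (x : R) : 0 <= x -> x <= 1 -> exists a : I, a%:num = x.
Proof. by move=> x0 x1; exists (Itv01 x0 x1). Qed.

Lemma ui_oplusP (a b c : I) :
  ui_oplus a b = Some c <-> a%:num + b%:num = c%:num.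
Proof.
rewrite /ui_oplus; split=> [|->]; last exact: valK.
by case: insubP => // u _ <- [->].
Qed.

Fact ui_ea_le (a b : I) : a <= b <-> exists c, ui_oplus a c = Some b.
Proof.
split=> [|[c /ui_oplusP h]]; rewrite ui_leE; last by rewrite -h lerDl.
move=> ab; have [||c hc] := @ui_of (b%:num - a%:num).
- by rewrite subr_ge0.
- by rewrite lerBlDr (le_trans (le1 b)) // lerDl.
by exists c; apply/ui_oplusP; rewrite hc addrC subrK.
Qed.

Fact ui_oplusC a b c : ui_oplus a b = Some c -> ui_oplus b a = Some c.
Proof. by move=> /ui_oplusP h; apply/ui_oplusP; rewrite addrC. Qed.

Fact ui_oplus0 a : ui_oplus a \bot%O = Some a.
Proof. by apply/ui_oplusP; rewrite ui_bot addr0. Qed.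

Fact ui_oplusA a b c ab s : ui_oplus a b = Some ab -> ui_oplus ab c = Some s ->
  exists bc, ui_oplus b c = Some bc /\ ui_oplus a bc = Some s.
Proof.
move=> /ui_oplusP h1 /ui_oplusP h2.
have e : a%:num + (b%:num + c%:num) = s%:num by rewrite addrA h1.
have [||bc hbc] := @ui_of (b%:num + c%:num); first exact: addr_ge0.
  by apply: le_trans (le1 s); rewrite -e lerDr.
by exists bc; split; apply/ui_oplusP; rewrite hbc.
Qed.

Fact ui_ocomplP a b : ui_oplus a b = Some \top%O <-> b = ui_ocompl a.
Proof.
split=> [/ui_oplusP h|->]; last by apply/ui_oplusP; rewrite ui_top addrC subrK.
by apply: ui_inj; rewrite -[RHS]/(1 - a%:num) -ui_top -h addrC addKr.
Qed.

Fact ui_oplus1 a s : ui_oplus a \top%O = Some s -> a = \bot%O.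
Proof.
move=> /ui_oplusP; rewrite ui_top => h; apply/ui_inj/le_anti.
by rewrite ge0 -(lerD2r 1) h add0r le1.
Qed.

Definition ui_ea : effect_algebra I :=
  EffectAlgebra ui_ea_le ui_oplusC ui_oplus0 ui_oplusA ui_ocomplP ui_oplus1.

Lemma ui_mul_law : effect_monoid_law ui_ea ui_mul.
Proof.
split.
- by move=> x y z; apply: ui_inj; rewrite /= mulrA.
- by move=> x; apply: ui_inj; rewrite /= mulr1.
- by move=> x; apply: ui_inj; rewrite /= mul1r.
- by move=> x y z s /ui_oplusP h; apply/ui_oplusP; rewrite /= -mulrDr h.
- by move=> x y z s /ui_oplusP h; apply/ui_oplusP; rewrite /= -mulrDl h.
Qed.

Lemma ui_omega : omega_complete I.
Proof.
move=> a _; set A : set R := range (fun n => (a n)%:num).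
have hA : has_sup A.
  split; first by exists (a 0%N)%:num, 0%N.
  by exists 1 => _ [n _ <-]; apply: le1.
have ub n : (a n)%:num <= sup A by apply: ub_le_sup; [case: hA|exists n].
have [||s hs] := @ui_of (sup A); first exact: le_trans (ub 0%N).
  by apply: ge_sup; [case: hA|move=> _ [n _ <-]; apply: le1].
exists s; split=> [_ [n _ <-]|x hx]; rewrite ui_leE hs //.
apply: ge_sup; first by case: hA.
by move=> _ [n _ <-]; apply: (hx (a n)); exists n.
Qed.

Definition ui_kmonoid : kmonoid :=
  @Kmonoid (ea_kalgebra ui_ea) ui_omega ui_ea (@ea_corr _ _ ui_ea) ui_mul
    ui_mul_law.
End UnitInterval.

(* Main.v *)
Require Import Defs.
From HB Require Import structures.
From mathcomp Require Import all_boot all_order all_algebra.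
From mathcomp Require Import boolp classical_sets reals interval_inference lra.

(** Write x' for the complement of x.  Everything rests on one remark: since
    a (b - c) <= b - c, multiplication in an omega-complete effect monoid
    preserves suprema of increasing sequences ([emul_lub]).  Hence a map
    r |-> x + G r, with G built from multiplications, has a fixpoint which is
    the supremum of its iterates ([least_fixpoint]), and a well-chosen fixpoint
    replaces each power series that one would like to write.

    - r = a + a' r gives an idempotent above a that is annihilated by whatever
      a annihilates ([emul_support]).  An idempotent p is central and splits M
      as [0, p] x [0, p'] ([kiso_corners]), so an irreducible M has no
      idempotents except 0 and 1, hence no zero divisors ([emul_eq0]).
    - q = x + q s' gives q s = x whenever x <= s: division ([edivision]).
    - the least solution of r = x + r x' r is the probability that a random
      walk on the integers, stepping up with probability x and down with
      probability x', ever climbs one level. For numbers it is min(1, x / x'),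
      so it decides between x <= x' and x' <= x; without zero divisors this
      argument makes sense in M ([random_walk], [compl_total]).

    By division the last point compares any two orthogonal elements, and then
    yields a half h (of 1) as soon as M has an element besides 0 and 1, because
    b = a a' is nonzero and b + b is defined ([half_ex]).  Comparing h x with
    h y shows that the order of M is total ([half_total]), and the first
    fixpoint shows that only 0 lies below all powers of h ([half_arch]).

    A totally ordered effect algebra with such halves has exactly one additive
    map to the nonnegative reals with value 1 at 1: it sends x to the supremum
    of the dyadic k / 2^n with k h^n <= x ([state], [state_unique]). Uniqueness
    makes it multiplicative, the Archimedean property makes it injective, and
    omega-completeness makes it onto [0, 1]: it is the required isomorphism
    ([kiso_unit_interval]).

    Conversely [0, 1] is not initial because {0, 1} has no half, not final
    because 0 <> 1, and irreducible because a product of two nontrivial monoids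
    has an idempotent besides 0 and 1. *)

Set Implicit Arguments.
Unset Strict Implicit.
Unset Printing Implicit Defensive.
Import Order.Theory.
Local Open Scope order_scope.

(** * Suprema and partial sums *)

Definition is_lub d (P : porderType d) (a : nat -> P) (s : P) :=
  forall x, s <= x <-> forall n, a n <= x.

Lemma is_lub_ub d (P : porderType d) (a : nat -> P) s n : is_lub a s -> a n <= s.
Proof. by move=> h; apply: (proj1 (h s)). Qed.

Lemma is_lub_uniq d (P : porderType d) (a : nat -> P) s t :
  is_lub a s -> is_lub a t -> s = t.
Proof.
move=> hs ht; apply/le_anti/andP.
by split; [apply/hs => n; apply: is_lub_ub ht|apply/ht => n; apply: is_lub_ub hs].
Qed.

Lemma is_lub_ex d (P : porderType d) (a : nat -> P) :
  omega_complete P -> (forall n, a n <= a n.+1) -> exists s, is_lub a s.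
Proof.
move=> /[apply] -[s [ub lb]]; exists s => x; split=> [sx n|h].
  by apply: le_trans sx; apply: ub; exists n.
by apply: lb => _ [n _ <-].
Qed.

Lemma is_lub_shift d (P : porderType d) (a : nat -> P) s :
  (forall n, a n <= a n.+1) -> is_lub a s -> is_lub (fun n => a n.+1) s.
Proof.
move=> ha h x; rewrite h; split=> H n //.
exact: le_trans (ha n) (H n).
Qed.

Section EffectAlgebra.
Context {d : Order.disp_t} {E : tbPOrderType d} (A : effect_algebra E).
Local Notation "a ^c" := (ocompl A a).
Implicit Types a b c x y z : E.

Lemma ocompl_le a b : a <= b -> b^c <= a^c.
Proof.
move=> /(ea_le A)[c /oplus_compl_eq/oplusC]; exact: oplus_le.
Qed.

Lemma oplus_oadd a b : b <= a^c -> oplus A a b = Some (oadd A a b).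
Proof. by move=> /oplus_perp[c h]; rewrite /oadd h. Qed.

Lemma oplus_homo a b b' c c' : b <= b' ->
  oplus A a b = Some c -> oplus A a b' = Some c' -> c <= c'.
Proof.
move=> /(ea_le A)[e he] h h'.
have [ab [h1 h2]] := oplusA' he h'.
by move: h1 h2; rewrite h => -[<-]; apply: oplus_le.
Qed.

Lemma oplus_reflect a b b' c c' : c <= c' ->
  oplus A a b = Some c -> oplus A a b' = Some c' -> b <= b'.
Proof.
move=> /(ea_le A)[e he] h h'.
have [be [h1 h2]] := oplusA h he.
by have <- := oplusI h2 h'; apply: oplus_le h1.
Qed.

Lemma oplus_sub a a' b c' : a <= a' -> oplus A a' b = Some c' ->
  exists2 c, oplus A a b = Some c & c <= c'.
Proof.
move=> aa' h; have [c hc] := oplus_def_le (oplusC h) aa'.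
exists c; first exact: oplusC.
exact: oplus_homo aa' hc (oplusC h).
Qed.

Lemma oplusACA a b ab c e ce s : oplus A a b = Some ab ->
  oplus A c e = Some ce -> oplus A ab ce = Some s ->
  exists ac be, [/\ oplus A a c = Some ac, oplus A b e = Some be
    & oplus A ac be = Some s].
Proof.
move=> h1 h2 h3; have [bce [h4 h5]] := oplusA h1 h3.
have [bc [h6 h7]] := oplusA' h2 h4.
have [be [h8 h9]] := oplusA (oplusC h6) h7.
by have [ac [h10 h11]] := oplusA' h9 h5; exists ac, be.
Qed.

Lemma oplus_eq0 a b : oplus A a b = Some a -> b = \bot.
Proof. by move=> h; apply: oplusI h (oplus0 A a). Qed.

Lemma ocompl_eq0 a : a^c = \bot -> a = \top.
Proof. by move=> h; rewrite -[a](ocomplK A) h ocompl0. Qed.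

Lemma oplus_lub a (b c : nat -> E) s : is_lub b s ->
  (forall n, oplus A a (b n) = Some (c n)) ->
  exists2 t, oplus A a s = Some t & is_lub c t.
Proof.
move=> hs h; have [t ht] : exists t, oplus A a s = Some t.
  by apply/oplus_perp/hs => n; apply/oplus_perp; exists (c n).
exists t => // x; split=> [tx n|hx].
  by apply: le_trans tx; apply: oplus_homo (is_lub_ub n hs) (h n) ht.
have /(ea_le A)[e he] : a <= x by apply: le_trans (hx 0); apply: oplus_le (h 0).
apply: (oplus_homo _ ht he); apply/hs => n.
exact: oplus_reflect (hx n) (h n) he.
Qed.
End EffectAlgebra.

(** * Effect monoids *)

(** Every one-sided statement below has its mirror image by passing to the
    opposite multiplication. *)
Lemma opp_law d (E : tbPOrderType d) (A : effect_algebra E) mul :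
  effect_monoid_law A mul -> effect_monoid_law A (fun x y => mul y x).
Proof. by case=> a b c e f; split=> // x y z; rewrite a. Qed.

Section EffectMonoid.
Context {d : Order.disp_t} {E : tbPOrderType d} (A : effect_algebra E).
Variable mul : E -> E -> E.
Hypothesis law : effect_monoid_law A mul.
Local Notation "a ^c" := (ocompl A a).
Local Notation "x * y" := (mul x y).
Implicit Types a b c x y z : E.

Lemma emul0 x : x * \bot = \bot.
Proof. exact: (oplus_eq0 (emulDr law x (oplus0 A \bot))). Qed.

Lemma emul_homor x y z : y <= z -> x * y <= x * z.
Proof. by move=> /(ea_le A)[c /(emulDr law x)]; apply: oplus_le. Qed.

Lemma emul_lel x y : x * y <= x.
Proof. by rewrite -[leRHS](emul1 law) emul_homor ?lex1. Qed.

Lemma emul_complr x y : oplus A (x * y) (x * y^c) = Some x.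
Proof. by rewrite (emulDr law x (oplus_compl A y)) (emul1 law). Qed.
End EffectMonoid.

Section EffectMonoidOpp.
Context {d : Order.disp_t} {E : tbPOrderType d} (A : effect_algebra E).
Variable mul : E -> E -> E.
Hypothesis law : effect_monoid_law A mul.
Local Notation "a ^c" := (ocompl A a).
Local Notation "x * y" := (mul x y).
Implicit Types a b c x y z : E.

Lemma e0mul x : \bot * x = \bot.
Proof. exact: emul0 (opp_law law) x. Qed.

Lemma emul_homol x y z : y <= z -> y * x <= z * x.
Proof. exact: (emul_homor (opp_law law)). Qed.

Lemma emul_ler x y : x * y <= y.
Proof. exact: (emul_lel (opp_law law)). Qed.

Lemma emul_compll x y : oplus A (x * y) (x^c * y) = Some y.
Proof. exact: (emul_complr (opp_law law)). Qed.

Lemma emul_complC x : x * x^c = x^c * x.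
Proof. exact: oplusI (emul_complr law x x) (emul_compll x x). Qed.

Lemma emul_homo x x' y y' : x <= x' -> y <= y' -> x * y <= x' * y'.
Proof.
by move=> h1 h2; apply: le_trans (emul_homor law _ h2) (emul_homol _ h1).
Qed.

Lemma emul_fix a b : a * b^c = \bot -> a * b = a.
Proof. by move=> h; have := emul_complr law a b; rewrite h oplus0 => -[]. Qed.

Hypothesis omega : omega_complete E.

(** With t the supremum of the a b_n and s that of the b_n, the defect
    e = a s - t is below a (s - b_n) <= s - b_n for every n; thus every b_n is
    below s - e, which forces e = 0. *)
Lemma emul_lub a (b : nat -> E) s : (forall n, b n <= b n.+1) ->
  is_lub b s -> is_lub (fun n => a * b n) (a * s).
Proof.
move=> hb hs.
have [t ht] := is_lub_ex omega (fun n => emul_homor law a (hb n)).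
have /(ea_le A)[e he] : t <= a * s.
  by apply/ht => n; apply: (emul_homor law); apply: is_lub_ub.
suff e0 : e = \bot by move: he; rewrite e0 oplus0 => -[<-].
have es n : exists2 c, oplus A (b n) c = Some s & e <= c.
  have /(ea_le A)[c hc] := is_lub_ub n hs; exists c => //.
  have /(ea_le A)[f hf] := is_lub_ub n ht.
  have [fe [h1 h2]] := oplusA hf he.
  have := oplusI h2 (emulDr law a hc) => fec; subst fe.
  exact: le_trans (oplus_ler h1) (emul_ler _ _).
have /(ea_le A)[s1 /oplusC hs1] : e <= s.
  by have [c h ec] := es 0; apply: le_trans ec (oplus_ler h).
apply: (@oplus_eq0 _ _ A s); rewrite -hs1; congr oplus.
apply/le_anti; rewrite (oplus_le hs1) andbT; apply/hs => n.
have [c h /(ea_le A)[g /oplusC hg]] := es n.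
have [bg [h1 h2]] := oplusA' hg h.
by rewrite (oplusI (oplusC hs1) (oplusC h2)); apply: oplus_le h1.
Qed.
End EffectMonoidOpp.

(** * Idempotents *)

(** Idempotents are given by p p' = 0, equivalent to p p = p: this is the form
    in which fixpoints provide them and in which monotonicity exploits them. *)
Section Idempotent.
Context {d : Order.disp_t} {E : tbPOrderType d} (A : effect_algebra E).
Variable mul : E -> E -> E.
Hypothesis law : effect_monoid_law A mul.
Local Notation "a ^c" := (ocompl A a).
Local Notation "x * y" := (mul x y).
Context (p : E) (pp : p * p^c = \bot).
Implicit Types a b : E.

Lemma idempotentC : p^c * p^c^c = \bot.
Proof. by rewrite (ocomplK A) -(emul_complC law). Qed.

Lemma idempotent_le a : a <= p -> p^c * a = \bot.
Proof.
move=> ap; apply/le_anti; rewrite le0x andbT -pp (emul_complC law).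
exact: (emul_homor law).
Qed.

Lemma idempotent_fix a : a <= p -> p * a = a.
Proof. by move=> /idempotent_le; apply: (emul_fix (opp_law law)). Qed.

(** The element p a p' is below p p' = 0, so p a = p a p; likewise a p = p a p. *)
Lemma idempotent_central a : p * a = a * p.
Proof.
have e1 : p * a * p = p * a.
  apply: (emul_fix law); apply/le_anti; rewrite le0x andbT -pp.
  exact: (emul_homol law _ (emul_lel law _ _)).
by rewrite -e1 -(emulA law) idempotent_fix ?(emul_ler law).
Qed.

Lemma idempotent_morph a b : p * (a * b) = (p * a) * (p * b).
Proof.
rewrite !(emulA law) idempotent_central -(emulA law a p p).
by rewrite (idempotent_fix (lexx p)).
Qed.
End Idempotent.

(** * Fixpoints, supports and division *)

Section OmegaEffectMonoid.
Context {d : Order.disp_t} {E : tbPOrderType d} (A : effect_algebra E).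
Variable mul : E -> E -> E.
Hypothesis law : effect_monoid_law A mul.
Hypothesis omega : omega_complete E.
Local Notation "a ^c" := (ocompl A a).
Local Notation "x * y" := (mul x y).
Implicit Types a b c x y z : E.

Lemma increasing_le (a : nat -> E) m n : (forall n, a n <= a n.+1) ->
  (m <= n)%N -> a m <= a n.
Proof. by move=> ha; apply: (homo_leq (@lexx _ _) (@le_trans _ _)). Qed.

Lemma emul_lub2 (a b : nat -> E) s t : (forall n, a n <= a n.+1) ->
  (forall n, b n <= b n.+1) -> is_lub a s -> is_lub b t ->
  is_lub (fun n => a n * b n) (s * t).
Proof.
move=> ha hb hs ht x; split=> [stx n|h].
  by apply: le_trans stx; apply: (emul_homo law); apply: is_lub_ub.
apply/(emul_lub (opp_law law) omega t ha hs) => m.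
apply/(emul_lub law omega (a m) hb ht) => n.
apply: le_trans (h (maxn m n)).
by apply: (emul_homo law); apply: increasing_le; rewrite ?leq_maxl ?leq_maxr.
Qed.

(** Kleene's theorem.  The iterates are part of the conclusion so that
    properties of the fixpoint can be proved by induction along them. *)
Lemma least_fixpoint x (G : E -> E) :
  (forall r, G r <= x^c) -> {homo G : r s / r <= s} ->
  (forall (a : nat -> E) s, (forall n, a n <= a n.+1) -> is_lub a s ->
     is_lub (fun n => G (a n)) (G s)) ->
  exists (a : nat -> E) (r : E), [/\ a 0 = \bot,
    forall n, oplus A x (G (a n)) = Some (a n.+1),
    is_lub a r & oplus A x (G r) = Some r].
Proof.
move=> Gx Gle Glub; pose a n := iter n (fun r => oadd A x (G r)) \bot.
have aS n : oplus A x (G (a n)) = Some (a n.+1) by apply: oplus_oadd.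
have ai n : a n <= a n.+1.
  elim: n => [|n IH]; first exact: le0x.
  exact: oplus_homo (Gle _ _ IH) (aS n) (aS n.+1).
have [r hr] := is_lub_ex omega ai; exists a, r; split=> //.
have [t ht /(is_lub_uniq (is_lub_shift ai hr)) rt] := oplus_lub (Glub a r ai hr) aS.
by rewrite ht rt.
Qed.

Lemma emul_fixpoint a : exists (b : nat -> E) (r : E), [/\ b 0 = \bot,
    forall n, oplus A a (a^c * b n) = Some (b n.+1),
    is_lub b r & oplus A a (a^c * r) = Some r].
Proof.
apply: (@least_fixpoint a (mul a^c)) => [r|r s|b s]; first exact: emul_lel law _ _.
  exact: emul_homor law _ _ _.
exact: (emul_lub law omega).
Qed.

Lemma emul_fixpoint_id a r : oplus A a (a^c * r) = Some r -> a * r^c = \bot.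
Proof.
move=> h; have ar : a * r = a.
  exact: oplusI (oplusC (emul_compll law a r)) (oplusC h).
by have := emul_complr law a r; rewrite ar => /oplus_eq0.
Qed.

(** For a number a this is the geometric series a + a' a + a'^2 a + ..., with
    value 1 unless a = 0.  In general it annihilates what a annihilates, in
    particular its own complement. *)
Lemma emul_support a : exists q, [/\ a <= q, q * q^c = \bot &
  forall b, a * b = \bot -> q * b = \bot].
Proof.
have [u [q [u0 uS hq eq]]] := emul_fixpoint a; exists q.
have qb b : a * b = \bot -> q * b = \bot.
  move=> ab; have ub n : u n * b = \bot.
    elim: n => [|n IH]; first by rewrite u0 (e0mul law).
    have := emulDl law b (uS n); rewrite ab -(emulA law) IH (emul0 law) oplus0.
    by case.
  apply/le_anti; rewrite le0x andbT.
  have ui n : u n <= u n.+1.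
    elim: n => [|n IH]; first by rewrite u0 le0x.
    exact: oplus_homo (emul_homor law _ IH) (uS n) (uS n.+1).
  by apply/(emul_lub (opp_law law) omega b ui hq) => n; rewrite ub.
split=> //; first exact: oplus_le eq.
exact/qb/emul_fixpoint_id.
Qed.

(** The fixpoint of q = x + q s' is the sum of the x s'^n, that is, x / s; as
    q = q s + q s', comparison of the two decompositions gives q s = x. *)
Lemma edivision x s : x <= s -> exists q, q * s = x.
Proof.
move=> xs; have [|r t|u t ui hu|_ [q [_ _ _ eq]]] :=
  @least_fixpoint x (fun r => r * s^c).
- by move=> r; apply: le_trans (emul_ler law _ _) (ocompl_le A xs).
- exact: (emul_homol law).
- exact: (emul_lub (opp_law law) omega).
exists q; apply: oplusI (oplusC _) (oplusC eq).
by have := emul_complr law q s.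
Qed.

(** For numbers, r = x + x' r^2 says (r x' - x) (r - 1) = 0, and the least
    solution is the probability of ever climbing one level.  The order of the
    factors in r x' r lets the bounds r x' <= x and x' r <= x pass from each
    iterate to the next without commutativity. *)
Lemma random_walk x :
  exists r z, oplus A (r * x^c) z = Some x /\ z * r^c = \bot.
Proof.
have [|r s rs|u t ui hu|u [r [u0 uS hr er]]] :=
  @least_fixpoint x (fun r => r * (x^c * r)).
- by move=> r; rewrite (emulA law); apply: le_trans (emul_lel law _ _) (emul_ler law _ _).
- by apply: (emul_homo law) => //; apply: (emul_homor law).
- apply: emul_lub2 => // [n|]; first exact: (emul_homor law).
  exact: (emul_lub law omega).
have ui n : u n <= u n.+1.
  elim: n => [|n IH]; first by rewrite u0 le0x.
  apply: oplus_homo (uS n) (uS n.+1).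
  by apply: (emul_homo law) => //; apply: (emul_homor law).
have ux n : u n * x^c <= x /\ x^c * u n <= x.
  elim: n => [|n [IH1 IH2]].
    by rewrite u0 (emul0 law) (e0mul law) !le0x.
  split.
    apply: (oplus_homo _ (emulDl law x^c (uS n)) (oplusC (emul_complr law x x))).
    by rewrite -!(emulA law) (emulA law (u n)); apply: (emul_homo law).
  have xx : oplus A (x^c * x) (x * x) = Some x by apply/oplusC/(emul_compll law).
  apply: (oplus_homo _ (emulDr law x^c (uS n)) xx).
  by rewrite !(emulA law) -(emulA law); apply: (emul_homo law).
have rx : r * x^c <= x.
  by apply/(emul_lub (opp_law law) omega x^c ui hr) => n; case: (ux n).
have xr : x^c * r <= x.
  by apply/(emul_lub law omega x^c ui hr) => n; case: (ux n).
(* Substituting x + r x' r for r in r = r x + r x', and in r = x r + x' r,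
   and cancelling r x' r. *)
have e1 : oplus A (r * x) (r * (x^c * r^c)) = Some x.
  have h1 := emul_complr law (r * x^c) r; rewrite -!(emulA law) in h1.
  have [y [h2 h3]] := oplusA' (oplusC h1) (emul_complr law r x).
  by rewrite h2; congr Some; apply: oplusI (oplusC h3) (oplusC er).
have e2 : oplus A (x * r) (r^c * (x^c * r)) = Some x.
  have h1 := emul_compll law r (x^c * r).
  have [y [h2 h3]] := oplusA' (oplusC h1) (emul_compll law x r).
  by rewrite h2; congr Some; apply: oplusI (oplusC h3) (oplusC er).
have e3 : r^c * x = r * (x^c * r^c) := oplusI (emul_compll law r x) e1.
have e4 : x * r^c = r^c * (x^c * r) := oplusI (emul_complr law x r) e2.
(* x r' = r' x' r <= r' x = r x' r' <= x r' *)
have e5 : r * (x^c * r^c) = x * r^c.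
  apply/le_anti; rewrite (emulA law) (emul_homol law) //= -(emulA law) -e3 e4.
  exact: (emul_homor law).
have /(ea_le A)[z hz] := rx; exists r, z; split=> //.
have := emulDl law r^c hz; rewrite -(emulA law) e5.
exact: oplus_eq0.
Qed.

(** * Effect monoids without proper idempotents *)

Section NoIdempotent.
Hypothesis idem : forall p, p * p^c = \bot -> p = \bot \/ p = \top.

Lemma emul_eq0 a b : a * b = \bot -> a = \bot \/ b = \bot.
Proof.
have [q [aq /idem[] qE qb]] := emul_support a; last first.
  by move=> /qb; rewrite qE (e1mul law); right.
by left; apply/le_anti; rewrite le0x andbT -[leRHS]qE.
Qed.

Lemma compl_total x : x <= x^c \/ x^c <= x.
Proof.
have [r [z [hz /emul_eq0[z0|r0]]]] := random_walk x.
  left; rewrite z0 oplus0 in hz; case: hz => e; rewrite -[leLHS]e.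
  exact: (emul_ler law).
by right; have := oplus_le hz; rewrite (ocompl_eq0 r0) (e1mul law).
Qed.

(** With s = x + y and x = q s one has y = q' s, so q versus q' decides. *)
Lemma perp_total x y s : oplus A x y = Some s -> x <= y \/ y <= x.
Proof.
move=> h; have [q qs] := edivision (oplus_le h).
have <- : q^c * s = y.
  by apply: oplusI h; rewrite -{1}qs; apply: (emul_compll law).
by rewrite -qs; case: (compl_total q) => le; [left|right]; apply: (emul_homol law).
Qed.

(** The element b = a a' is nonzero, a not being idempotent, and
    b + b = a a' + a' a <= a + a' is defined; a half of 1 is then b / (b + b)
    or its complement, whichever is the smaller. *)
Lemma half_ex a : a <> \bot -> a <> \top -> exists h, oplus A h h = Some \top.
Proof.
move=> a0 a1.
have b0 : a * a^c <> \bot by move=> /idem[].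
set b := a * a^c in b0.
have [s hs] : exists s, oplus A b b = Some s.
  have [c hc _] := oplus_sub (emul_lel law a a^c) (oplus_compl A a).
  apply: (oplus_def_le hc); rewrite /b (emul_complC law).
  exact: (emul_lel law).
have [q qs] := edivision (oplus_le hs).
have q's : q^c * s = b.
  by apply: oplusI hs; rewrite -{1}qs; apply: (emul_compll law).
have key r : r * s = b -> r <= r^c -> oplus A r r = Some \top.
  move=> rs /oplus_perp[t ht]; rewrite ht.
  have := emulDl law s ht; rewrite rs hs => -[st].
  have /emul_eq0[/ocompl_eq0->//|s0] : t^c * s = \bot.
    by have := emul_compll law t s; rewrite -st => /oplus_eq0.
  case: b0; apply/le_anti; rewrite le0x andbT -s0.
  exact: oplus_le hs.
have [qq|qq] := compl_total q; first by exists q; apply: key.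
by exists q^c; apply: key; rewrite ?(ocomplK A).
Qed.

Section Half.
Context (h : E) (hh : oplus A h h = Some \top).

Lemma half_double x : oplus A (h * x) (h * x) = Some x.
Proof. by have := emulDl law x hh; rewrite (e1mul law). Qed.

(** The elements h x and h y are orthogonal, hence comparable, and doubling
    recovers x and y from them. *)
Lemma half_total x y : x <= y \/ y <= x.
Proof.
have [s hs] : exists s, oplus A (h * x) (h * y) = Some s.
  have [c hc _] := oplus_sub (emul_lel law h x) hh.
  by apply: oplus_def_le hc _; apply: (emul_lel law).
have mono u v : h * u <= h * v -> u <= v.
  move=> le; have [c hc] := oplus_def_le (half_double v) le.
  apply: le_trans (oplus_homo le hc (half_double v)).
  exact: oplus_homo le (half_double u) (oplusC hc).
by case: (perp_total hs) => /mono; [left|right].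
Qed.

Fixpoint half_pow n := if n is n'.+1 then h * half_pow n' else \top.

Lemma half_powS n : oplus A (half_pow n.+1) (half_pow n.+1) = Some (half_pow n).
Proof. exact: half_double. Qed.

(** The complements of the powers of h are the iterates of r |-> h + h' r, whose
    fixpoint is 1 for want of zero divisors. *)
Lemma half_arch e : (forall n, e <= half_pow n) -> e = \bot.
Proof.
move=> he; have [u [r [u0 uS hr er]]] := emul_fixpoint h.
have h'h : h^c = h by apply/esym/(ocomplP A).
have uh n : oplus A (u n) (half_pow n) = Some \top.
  elim: n => [|n IH]; first by rewrite u0 oplus0l.
  have := emulDr law h IH; rewrite (emul1 law) => h1.
  have := uS n; rewrite h'h => h2.
  by have [v [h3 h4]] := oplusA' h1 hh; rewrite h2 in h3; case: h3 => ->.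
have [h0|/ocompl_eq0 r1] := emul_eq0 (emul_fixpoint_id er).
  by have := he 1; rewrite /= h0 (e0mul law) lex0 => /eqP.
have : r <= e^c.
  apply/hr => n; apply/oplus_perp.
  have [c hc _] := oplus_sub (he n) (oplusC (uh n)).
  by exists c.
by rewrite r1 le1x => /eqP/(congr1 (ocompl A)); rewrite (ocomplK A) ocompl1.
Qed.
End Half.
End NoIdempotent.
End OmegaEffectMonoid.

(** * Multiples in a totally ordered effect algebra *)

Section Multiples.
Context {d : Order.disp_t} {E : tbPOrderType d} (A : effect_algebra E).
Implicit Types (a b x y z : E) (k l n : nat).

(** The relation k a <= x, phrased by subtracting a from x repeatedly so that
    no multiple of a has to be defined. *)
Fixpoint fits a k x : Prop :=
  if k is k'.+1 then exists2 y, oplus A a y = Some x & fits a k' y else True.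

Lemma fits_le a k x y : x <= y -> fits a k x -> fits a k y.
Proof.
elim: k x y => //= k IH x y /(ea_le A)[z hz] [u hu fu].
have [v [h1 h2]] := oplusA hu hz; exists v => //.
exact: IH (oplus_le h1) fu.
Qed.

Lemma fits_leq a k l x : (l <= k)%N -> fits a k x -> fits a l x.
Proof.
elim: k l x => [|k IH] [|l] x //= lk [y hy fy]; exists y => //.
exact: IH fy.
Qed.

Lemma fits_add a k l x y z : oplus A x y = Some z ->
  fits a k x -> fits a l y -> fits a (k + l) z.
Proof.
elim: k x z => [|k IH] x z h; first by move=> _; apply/fits_le/(oplus_ler h).
move=> [u hu fu] fl; have [v [h1 h2]] := oplusA hu h; exists v => //.
exact: IH fu fl.
Qed.

Lemma fits_sub a k x y : oplus A a y = Some x -> fits a k.+1 x -> fits a k y.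
Proof. by move=> h [z hz]; rewrite (oplusI h hz). Qed.

Lemma fits_double a b k x : oplus A b b = Some a ->
  fits a k x <-> fits b k.*2 x.
Proof.
move=> hb; elim: k x => //= k IH x; split=> [[y hy /IH fy]|[u hu [y hy fy]]].
  by have [u [h1 h2]] := oplusA hb hy; exists u => //; exists y.
have [c [h1 h2]] := oplusA' hy hu; exists y; last exact/IH.
by move: h1 h2; rewrite hb => -[->].
Qed.

Hypothesis total : forall x y, x <= y \/ y <= x.

(** Contrapositive of: x < k a and y < l a imply x + y < (k + l) a.  The
    induction removes one a from x or from y, whichever it fits into. *)
Lemma fits_split a k l x y z : oplus A x y = Some z ->
  fits a (k + l) z -> fits a k x \/ fits a l y.
Proof.
have [m mkl] : exists m, (k + l <= m)%N by exists (k + l)%N.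
elim: m k l x y z mkl => [|m IH] [|k] [|l] x y z // mkl h f; try by [left|right].
(* If x <= a then a + a <= x + y still leaves a <= y, as k and l are positive. *)
have [/(ea_le A)[x' hx]|/(ea_le A)[y' hy]] : a <= x \/ a <= y.
- have [|xa] := total a x; first by left.
  right; move: f; rewrite addnS addSn => -[u hu [v hv _]].
  have [a2 [h1 h2]] := oplusA' hv hu; have /(ea_le A)[x' hx] := xa.
  have [x'a [h3 h4]] := oplusA hx h1.
  by apply: le_trans (oplus_ler h3) _; apply: oplus_reflect (oplus_le h2) h4 h.
- have [z' [h1 h2]] := oplusA hx h.
  have /(IH _ _ _ _ _ _ h1)[|fx|fy] : fits a (k + l.+1) z'.
  + by apply: fits_sub h2 _; rewrite -addSn.
  + by move: mkl; rewrite addSn.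
  + by left; exists x'.
  + by right.
- have [z' [h1 h2]] := oplusA hy (oplusC h).
  have /(IH _ _ _ _ _ _ (oplusC h1))[|fx|fy] : fits a (k.+1 + l) z'.
  + by apply: fits_sub h2 _; rewrite -addnS.
  + by move: mkl; rewrite addnS.
  + by left.
  + by right; exists y'.
Qed.
End Multiples.

Section AdditiveFunction.
Import GRing.Theory Num.Theory.
Local Open Scope ring_scope.
Context {d : Order.disp_t} {E : tbPOrderType d} (A : effect_algebra E).
Context {R : realType} (g : E -> R).
Hypothesis g_add : forall x y z, oplus A x y = Some z -> g x + g y = g z.
Hypothesis g_ge0 : forall x, 0 <= g x.

Lemma additive_homo x y : (x <= y)%O -> g x <= g y.
Proof. by move=> /(ea_le A)[z /g_add <-]; rewrite lerDl. Qed.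

Lemma additive_fits a k x : fits A a k x -> k%:R * g a <= g x.
Proof.
elim: k x => [|k IH] x /=; first by rewrite mul0r.
by move=> [y /g_add <- /IH h]; rewrite -natr1; lra.
Qed.

Lemma additive_nfits (total : forall x y : E, (x <= y \/ y <= x)%O) a k x :
  ~ fits A a k x -> g x <= k%:R * g a.
Proof.
elim: k x => [|k IH] x /=; first by move=> /(_ I).
move=> nf; have := g_ge0 a; have : 0 <= k%:R :> R by [].
rewrite -natr1; have [/(ea_le A)[y hy]|/additive_homo] := total a x; last first.
  by move=> *; nra.
have /IH : ~ fits A a k y by move=> fy; apply: nf; exists y.
by rewrite -(g_add hy); lra.
Qed.
End AdditiveFunction.

(** * The state determined by repeated halving *)

Section State.
Import GRing.Theory Num.Theory.
Local Open Scope ring_scope.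
Context {d : Order.disp_t} {E : tbPOrderType d} (A : effect_algebra E).
Implicit Types (x y z : E) (k l m n : nat).
Hypothesis total : forall x y : E, (x <= y \/ y <= x)%O.
Variable H : nat -> E.
Hypothesis H0 : H 0 = \top%O.
Hypothesis HS : forall n, oplus A (H n.+1) (H n.+1) = Some (H n).
Hypothesis top_bot : (\top : E)%O <> \bot%O.

Lemma halving_neq0 n : H n <> \bot%O.
Proof.
elim: n => [|n IH h]; first by rewrite H0.
by have := HS n; rewrite h oplus0 => -[/esym].
Qed.

Lemma fits_halving n m k x : fits A (H n) k x <-> fits A (H (n + m)) (k * 2 ^ m) x.
Proof.
elim: m => [|m IH]; first by rewrite addn0 muln1.
by rewrite IH addnS (fits_double _ _ (HS _)) expnS mulnCA mul2n.
Qed.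

(** The element 1 is the sum of exactly 2^n copies of H n, and H n is nonzero. *)
Lemma fits_bound n k x : fits A (H n) k x -> (k <= 2 ^ n)%N.
Proof.
(* Removing H m = 2^j H (m + j) uses up exactly 2^j copies of H (m + j). *)
have sub j : forall m y z l, oplus A (H m) y = Some z ->
    fits A (H (m + j)) (2 ^ j + l) z -> fits A (H (m + j)) l y.
  elim: j => [|j IH] m y z l h; first by rewrite addn0; apply: fits_sub h.
  have [u [h1 h2]] := oplusA (HS m) h.
  rewrite -addSnnS expnS mul2n -addnn -addnA => f.
  exact: IH h1 (IH _ _ _ _ h2 f).
move=> /(fits_le (lex1 x)); rewrite leqNgt => f; apply/negP => lt.
have h : oplus A (H 0) \bot%O = Some \top%O by rewrite H0 oplus0.
have := sub n 0 _ _ (k - 2 ^ n)%N h; rewrite (add0n n) (subnKC (ltnW lt)) => /(_ f).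
move: lt; rewrite -subn_gt0; case: (k - _)%N => // l _ [u hu _].
by apply: (@halving_neq0 n); apply/le_anti; rewrite le0x andbT (oplus_le hu).
Qed.

Lemma fits_floor n x :
  exists2 k, fits A (H n) k x & ~ fits A (H n) k.+1 x.
Proof.
apply: contrapT => no; have /fits_bound : fits A (H n) (2 ^ n).+1 x.
  elim: (2 ^ n).+1 => // k fk; apply: contrapT => nf; apply: no.
  by exists k.
by rewrite ltnn.
Qed.

Lemma fits_nfits n m k l x : fits A (H n) k x -> ~ fits A (H m) l x ->
  (k * 2 ^ m < l * 2 ^ n)%N.
Proof.
move=> /(fits_halving n m) fk; rewrite (fits_halving m n) addnC => nfl.
by rewrite ltnNge; apply/negP => le; apply: nfl; apply: fits_leq le fk.
Qed.

Variable R : realType.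

Definition state x : R :=
  sup [set r | exists n k, fits A (H n) k x /\ r = k%:R / 2 ^+ n]%classic.

Lemma dyadic_le k l n m : (k * 2 ^ m <= l * 2 ^ n)%N ->
  k%:R / 2 ^+ n <= l%:R / 2 ^+ m :> R.
Proof.
by rewrite -(ler_nat R) !natrM !natrX ler_pdivrMr ?exprn_gt0 // mulrAC
  ler_pdivlMr ?exprn_gt0.
Qed.

Lemma state_ge n k x : fits A (H n) k x -> k%:R / 2 ^+ n <= state x.
Proof.
move=> f; apply: ub_le_sup; last by exists n, k.
exists 1 => _ [m [l [/fits_bound le ->]]].
by rewrite ler_pdivrMr ?exprn_gt0 // mul1r -natrX ler_nat.
Qed.

Lemma state_le n k x : ~ fits A (H n) k x -> state x <= k%:R / 2 ^+ n.
Proof.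
move=> nf; apply: ge_sup; first by exists 0, 0, 0; split; rewrite ?mul0r.
move=> _ [m [l [f ->]]]; apply: dyadic_le; apply: ltnW.
exact: fits_nfits f nf.
Qed.

Lemma state_ge0 x : 0 <= state x.
Proof. by have := @state_ge 0 0 x I; rewrite mul0r. Qed.

Lemma state1 : state \top%O = 1.
Proof.
apply/eqP; rewrite eq_le; apply/andP; split.
  apply: ge_sup; first by exists 0, 0, 0; split; rewrite ?mul0r.
  move=> _ [m [l [/fits_bound le ->]]].
  by rewrite ler_pdivrMr ?exprn_gt0 // mul1r -natrX ler_nat.
have : fits A (H 0) 1 \top%O by exists \bot%O => //; rewrite H0 oplus0.
by move=> /state_ge; rewrite expr0 divr1.
Qed.

Lemma dyadic_arch (x c : R) : (forall n, `|x| <= c / 2 ^+ n) -> x = 0.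
Proof.
move=> h; apply/eqP; rewrite -normr_eq0; apply/eqP/le_anti; rewrite normr_ge0 andbT.
rewrite leNgt; apply/negP => x0.
have := h (Num.bound (c / `|x|)).
rewrite ler_pdivlMr ?exprn_gt0 // leNgt => /negP; apply.
have c0 : 0 <= c by have := h 0; rewrite expr0 divr1; apply: le_trans.
rewrite mulrC -ltr_pdivrMr //.
have /archi_boundP : 0 <= c / `|x| by rewrite divr_ge0.
move=> /lt_trans; apply; rewrite -natrX ltr_nat; exact: ltn_expl.
Qed.

(** If k and l are the integer parts of x and y in units of H n, then x + y is
    at least k + l and less than k + l + 2 units; let n grow. *)
Lemma state_add x y z : oplus A x y = Some z -> state x + state y = state z.
Proof.
move=> h; apply/eqP; rewrite -subr_eq0; apply/eqP/(@dyadic_arch _ 2) => n.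
have [k fk nfk] := fits_floor n x; have [l fl nfl] := fits_floor n y.
have := state_ge (fits_add h fk fl).
have nf : ~ fits A (H n) (k.+1 + l.+1) z.
  by move=> /(fits_split total h)[].
have := state_le nf; have := state_ge fk; have := state_le nfk.
have := state_ge fl; have := state_le nfl.
rewrite addnS addSn -!natr1 !mulrDl natrD mulrDl ler_norml.
by move=> *; apply/andP; split; lra.
Qed.

Lemma additive_halving (g : E -> R) n :
  (forall x y z, oplus A x y = Some z -> g x + g y = g z) ->
  g (H n) = g \top%O / 2 ^+ n.
Proof.
move=> ga; elim: n => [|n IH]; first by rewrite H0 expr0 divr1.
have := ga _ _ _ (HS n); rewrite IH exprS invfM; lra.
Qed.

(** Any additive g >= 0 satisfies g (H n) = g 1 / 2^n, so the dyadic bounds for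
    x confine g x and g 1 * state x to the same interval of length g 1 / 2^n. *)
Lemma state_unique (g : E -> R) :
  (forall x y z, oplus A x y = Some z -> g x + g y = g z) ->
  (forall x, 0 <= g x) -> forall x, g x = g \top%O * state x.
Proof.
move=> ga g0 x; apply/eqP; rewrite -subr_eq0; apply/eqP.
apply/(@dyadic_arch _ (g \top%O)) => n.
have [k fk nfk] := fits_floor n x.
have := state_ge fk; have := state_le nfk.
have := additive_fits ga g0 fk; have := additive_nfits ga g0 total nfk.
rewrite additive_halving // !mulrA -!natr1 ler_norml.
have := g0 \top%O; set c := g \top%O; set t := (2 ^- n : R); set s := state x.
set K := k%:R => c0 h1 h2 h3 h4.
have := ler_wpM2l c0 h3; have := ler_wpM2l c0 h4; rewrite !mulrA.
by move=> *; apply/andP; split; nra.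
Qed.

Hypothesis arch : forall e, (forall n, (e <= H n)%O) -> e = \bot%O.

Lemma state_eq0 x : state x = 0 -> x = \bot%O.
Proof.
move=> x0; apply: arch => n; have [//|le] := total x (H n).
have /state_ge : fits A (H n) 1 x.
  by have /(ea_le A)[y hy] := le; exists y.
by rewrite x0 div1r invr_le0 leNgt exprn_gt0.
Qed.

Lemma state_reflect x y : state x <= state y -> (x <= y)%O.
Proof.
move=> le; have [//|/(ea_le A)[z hz]] := total x y.
have zE := state_add hz; have z0 := state_ge0 z.
have : state z = 0 by lra.
by move=> /state_eq0 e; move: hz; rewrite e oplus0 => -[->].
Qed.

Lemma state_inj : injective state.
Proof. by move=> x y e; apply/le_anti; rewrite !state_reflect ?e. Qed.

Lemma state_homo x y : (x <= y)%O -> state x <= state y.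
Proof. exact: (additive_homo state_add state_ge0). Qed.

Lemma state_le1 x : state x <= 1.
Proof. by rewrite -state1 state_homo ?lex1. Qed.

Lemma state_compl x : state (ocompl A x) = 1 - state x.
Proof. by have := state_add (oplus_compl A x); rewrite state1; lra. Qed.

Lemma state_perp x y : state x + state y <= 1 -> exists z, oplus A x y = Some z.
Proof.
by move=> h; apply/oplus_perp/state_reflect; rewrite state_compl; lra.
Qed.

Lemma state_dyadic n k : (k <= 2 ^ n)%N -> exists x, state x = k%:R / 2 ^+ n.
Proof.
have HE m : state (H m) = 1 / 2 ^+ m.
  by rewrite (additive_halving _ state_add) state1.
elim: k => [|k IH] le.
  exists \bot%O; have := state_add (oplus0 A \bot%O); rewrite mul0r; lra.
have [x ex] := IH (ltnW le).
have e : state x + state (H n) = k.+1%:R / 2 ^+ n.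
  by rewrite ex HE -mulrDl natr1.
have [|z /state_add hz] := @state_perp x (H n); last by exists z; rewrite -hz.
by rewrite e ler_pdivrMr ?exprn_gt0 // mul1r -natrX ler_nat.
Qed.

Hypothesis omega : omega_complete E.

(** The supremum of the elements with value floor (2^n t) / 2^n has value t,
    because it lies below every element of dyadic value at least t. *)
Lemma state_surj (t : R) : 0 <= t -> t <= 1 -> exists x, state x = t.
Proof.
move=> t0 t1; pose k n := Num.truncn (t * 2 ^+ n).
have kt n : (k n)%:R / 2 ^+ n <= t.
  by rewrite ler_pdivrMr ?exprn_gt0 // truncn_le mulr_ge0 ?exprn_ge0.
have tk n : t <= (k n).+1%:R / 2 ^+ n.
  by rewrite ler_pdivlMr ?exprn_gt0 // ltW ?truncnS_gt.
have /choice[u uE] n : exists x, state x = (k n)%:R / 2 ^+ n.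
  apply: state_dyadic; rewrite -(ler_nat R) natrX.
  by have := le_trans (kt n) t1; rewrite ler_pdivrMr ?exprn_gt0 // mul1r.
have ui n : (u n <= u n.+1)%O.
  apply: state_reflect; rewrite !uE; apply: dyadic_le.
  rewrite expnS mulnA leq_pmul2r ?expn_gt0 // truncn_ge_nat.
    have := kt n; rewrite ler_pdivrMr ?exprn_gt0 // natrM exprS; lra.
  by rewrite mulr_ge0 ?exprn_ge0.
have [x hx] := is_lub_ex omega ui; exists x.
apply/eqP; rewrite -subr_eq0; apply/eqP/(@dyadic_arch _ 1) => n.
have xl : (k n)%:R / 2 ^+ n <= state x.
  by rewrite -uE; apply/state_homo/is_lub_ub.
have xu : state x <= (k n).+1%:R / 2 ^+ n.
  have [le|lt] := leqP (k n).+1 (2 ^ n).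
    have [y ey] := state_dyadic le; rewrite -ey; apply/state_homo/hx => m.
    by apply: state_reflect; rewrite uE ey; apply: le_trans (kt m) (tk n).
  apply: le_trans (state_le1 x) _.
  by rewrite ler_pdivlMr ?exprn_gt0 // mul1r -natrX ler_nat ltnW.
have kS : (k n).+1%:R / 2 ^+ n = (k n)%:R / 2 ^+ n + 1 / 2 ^+ n :> R.
  by rewrite -mulrDl natr1.
have := kt n; have := tk n; move: xu; rewrite kS ler_norml.
by move=> *; apply/andP; split; lra.
Qed.
End State.

(** * Initial segments of an effect monoid *)

Section Segment.
Context {d : Order.disp_t} {E : tbPOrderType d} (A : effect_algebra E) (p : E).

Definition segment := {x : E | x <= p}.

HB.instance Definition _ := SubChoice.on segment.
HB.instance Definition _ := [SubChoice_isSubPOrder of segment by <: with d].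

Implicit Types (x y z : segment).

Lemma segment_leE x y : (x <= y) = (val x <= val y).
Proof. by []. Qed.

Lemma segment_ex (a : E) : a <= p -> exists x : segment, val x = a.
Proof. by move=> h; exists (Sub a h). Qed.

Definition segment_bot : segment := exist _ \bot (le0x p).
Definition segment_top : segment := exist _ p (lexx p).

Fact segment_le0 x : segment_bot <= x.
Proof. by rewrite segment_leE le0x. Qed.

Fact segment_le1 x : x <= segment_top.
Proof. exact: (valP x). Qed.

HB.instance Definition _ := Order.hasBottom.Build d segment segment_le0.
HB.instance Definition _ := Order.hasTop.Build d segment segment_le1.

Definition segment_oplus x y : option segment :=
  obind insub (oplus A (val x) (val y)).

Lemma segment_oplusP x y z : segment_oplus x y = Some z <->
  oplus A (val x) (val y) = Some (val z).
Proof.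
rewrite /segment_oplus; split=> [|->] /=; last exact: valK.
by case: oplus => //= a; case: insubP => // u _ <- [->].
Qed.

Definition segment_ocompl x : segment := insubd segment_bot (odiff A (val x) p).

Fact segment_ea_le x y : x <= y <-> exists z, segment_oplus x z = Some y.
Proof.
rewrite segment_leE; split=> [/(ea_le A)[c hc]|[z /segment_oplusP/oplus_le//]].
have [z zc] := segment_ex (le_trans (oplus_ler hc) (valP y)).
by exists z; apply/segment_oplusP; rewrite zc.
Qed.

Fact segment_oplusC x y z :
  segment_oplus x y = Some z -> segment_oplus y x = Some z.
Proof. by move=> /segment_oplusP/oplusC h; apply/segment_oplusP. Qed.

Fact segment_oplus0 x : segment_oplus x \bot = Some x.
Proof. exact/segment_oplusP/oplus0. Qed.

Fact segment_oplusA x y z xy s :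
  segment_oplus x y = Some xy -> segment_oplus xy z = Some s ->
  exists yz, segment_oplus y z = Some yz /\ segment_oplus x yz = Some s.
Proof.
move=> /segment_oplusP h1 /segment_oplusP/(oplusA h1)[a [h2 h3]].
have [u ua] := segment_ex (le_trans (oplus_ler h3) (valP s)).
by subst a; exists u; split; apply/segment_oplusP.
Qed.

Fact segment_ocomplP x y :
  segment_oplus x y = Some \top <-> y = segment_ocompl x.
Proof.
have hx := odiffP A (valP x : val x <= p).
have e : val (segment_ocompl x) = odiff A (val x) p.
  by rewrite insubdK // -topredE /= (oplus_ler hx).
split=> [/segment_oplusP h|->]; last by apply/segment_oplusP; rewrite e.
by apply: val_inj; rewrite e; apply: oplusI h hx.
Qed.

Fact segment_oplus1 x s : segment_oplus x \top = Some s -> x = \bot.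
Proof.
move=> /segment_oplusP h; apply: val_inj.
have sp : val s = p.
  by apply/le_anti; rewrite (valP s) (oplus_ler h).
by rewrite sp in h; apply: oplus_eq0 (oplusC h).
Qed.

Definition segment_ea : effect_algebra segment :=
  EffectAlgebra segment_ea_le segment_oplusC segment_oplus0 segment_oplusA
    segment_ocomplP segment_oplus1.

Lemma segment_omega : omega_complete E -> omega_complete segment.
Proof.
move=> omega a ha.
have [s hs] := is_lub_ex omega (ha : forall n, val (a n) <= val (a n.+1)).
have sp : s <= p by apply/hs => n; apply: valP (a n).
exists (Sub s sp); split=> [_ [n _ <-]|x hx].
  by rewrite segment_leE; apply: (is_lub_ub n hs).
by rewrite segment_leE; apply/hs => n; apply: (hx (a n)); exists n.
Qed.

Variable mul : E -> E -> E.
Hypothesis law : effect_monoid_law A mul.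
Hypothesis pp : mul p (ocompl A p) = \bot.

Definition segment_mul x y : segment :=
  Sub (mul (val x) (val y)) (le_trans (emul_lel law _ _) (valP x)).

Lemma segment_mul_law : effect_monoid_law segment_ea segment_mul.
Proof.
split.
- by move=> x y z; apply: val_inj; apply: (emulA law).
- move=> x; apply: val_inj => /=; rewrite -(idempotent_central law pp).
  exact: (idempotent_fix law pp (valP x)).
- by move=> x; apply: val_inj; apply: (idempotent_fix law pp (valP x)).
- by move=> x y z s /segment_oplusP/(emulDr law (val x)) h; apply/segment_oplusP.
- by move=> x y z s /segment_oplusP/(emulDl law (val x)) h; apply/segment_oplusP.
Qed.
End Segment.

(** * Direct decompositions *)

Definition corner (M : kmonoid) (p : M)
    (pp : kmul p (ocompl (kea M) p) = \bot) : kmonoid :=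
  let A := segment_ea (kea M) p in
  @Kmonoid (ea_kalgebra A) (segment_omega (@komega M)) A (@ea_corr _ _ A)
    _ (segment_mul_law (kmul_law M) pp).

Lemma khom_bot (M N : kmonoid) (f : M -> N) : is_khom f -> f \bot = \bot.
Proof. by move=> hf; apply: oplus_eq0 (khom_add hf (oplus0 (kea M) \bot)). Qed.

(** A morphism from the one-element monoid identifies 0 and 1; that monoid is
    available as the segment below 0. *)
Lemma is_finalP (M : kmonoid) : is_final M <-> (\top : M) = \bot.
Proof.
have bb : kmul \bot (ocompl (kea M) \bot) = \bot :> M.
  by rewrite (e0mul (kmul_law M)).
split=> [/(_ (corner bb))[f hf _]|tb N].
  apply: etrans (esym (khom_top hf)) (etrans _ (khom_bot hf)).
  by congr f; apply: val_inj.
have M0 (x : M) : x = \bot by apply/le_anti; rewrite le0x andbT -tb lex1.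
exists (fun=> \bot) => [|g _ x]; last by rewrite [RHS]M0.
by split=> [|a b c _|a b]; rewrite ?oplus0 // [RHS]M0.
Qed.

(** The inverse of a bijective morphism is additive only if the morphism
    reflects orthogonality, because the sum is partial. *)
Lemma kiso_bij (M N : kmonoid) (f : M -> N) : is_khom f -> injective f ->
  (forall y, exists x, f x = y) ->
  (forall a b c, oplus (kea N) (f a) (f b) = Some c ->
     exists s, oplus (kea M) a b = Some s) ->
  kiso M N.
Proof.
move=> hf fI /choice[g fg] fr; exists f, g.
have gf : cancel f g by move=> x; apply: fI.
split=> //; split.
- by apply: fI; rewrite fg (khom_top hf).
- move=> a b c; rewrite -{1}(fg a) -{1}(fg b) => h; have [s hs] := fr _ _ _ h.
  by have := khom_add hf hs; rewrite h => -[->]; rewrite gf.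
- by move=> a b; apply: fI; rewrite (khom_mul hf) !fg.
Qed.

Section Corner.
Context (M : kmonoid) (p : M).
Hypothesis pp : kmul p (ocompl (kea M) p) = \bot.
Local Notation A := (kea M).
Local Notation law := (kmul_law M).

(** The map is a |-> (p a, p' a), with inverse (x, y) |-> x + y. *)
Lemma kiso_corners : kiso M (kprod (corner pp) (corner (idempotentC law pp))).
Proof.
pose f (a : M) : kprod (corner pp) (corner (idempotentC law pp)) :=
  (exist _ (kmul p a) (emul_lel law p a),
   exist _ (kmul (ocompl A p) a) (emul_lel law (ocompl A p) a)).
have fE a : oplus A (val (f a).1) (val (f a).2) = Some a by apply: (emul_compll law).
apply: (@kiso_bij _ _ f) => //.
- split=> [|a b c h|a b].
  + by congr pair; apply: val_inj; apply: (emul1 law).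
  + by apply/prod_oplusP; split; apply/segment_oplusP; apply: (emulDr law).
  + congr pair; apply: val_inj; apply: (idempotent_morph law) => //.
    exact: (idempotentC law pp).
- by move=> a b e; have := fE a; rewrite e fE => -[].
- move=> [x y]; have yp : val y <= ocompl A p := valP y.
  have py : kmul p (val y) = \bot.
    by have := idempotent_le law (idempotentC law pp) yp; rewrite (ocomplK A).
  have [s hs] : exists s, oplus A (val x) (val y) = Some s.
    by apply/oplus_perp/(le_trans yp)/ocompl_le/(valP x).
  exists s; congr pair; apply: val_inj => /=.
    have := emulDr law p hs.
    by rewrite (idempotent_fix law pp (valP x)) py oplus0 => -[].
  have := emulDr law (ocompl A p) hs.
  rewrite (idempotent_le law pp (valP x)) oplus0l => -[<-].
  exact: (idempotent_fix law (idempotentC law pp) yp).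
- move=> a b c /prod_oplusP[/segment_oplusP h1 /segment_oplusP h2].
  have [s hs] : exists s, oplus A (val c.1) (val c.2) = Some s.
    by apply/oplus_perp/(le_trans (valP c.2))/ocompl_le/(valP c.1).
  have [u [v [h3 h4 h5]]] := oplusACA h1 h2 hs.
  move: h3 h4; rewrite !fE => -[uE] [vE]; exists s.
  by rewrite uE vE.
Qed.

Lemma irreducible_idempotent : irreducible M -> p = \bot \/ p = \top.
Proof.
move=> /(_ _ _ kiso_corners)[] /is_finalP/(congr1 val)/= e; [left|right] => //.
by rewrite -[p](ocomplK A) e ocompl0.
Qed.
End Corner.

(** * The two-element monoid *)

Lemma two_is_initial (M : kmonoid) : (\top : M) <> \bot ->
  (forall a : M, a = \bot \/ a = \top) -> is_initial M.
Proof.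
move=> tb M2 N; pose f (a : M) : N := if a == \top then \top else \bot.
have f1 : f \top = \top by rewrite /f eqxx.
have f0 : f \bot = \bot by rewrite /f; case: eqP => // /esym.
exists f => [|g hg a]; last first.
  by case: (M2 a) => ->; rewrite ?f0 ?f1 ?(khom_bot hg) ?(khom_top hg).
split=> // [a b c|a b].
  case: (M2 a) => ->; first by rewrite f0 !oplus0l => -[->].
  case: (M2 b) => ->; first by rewrite f0 !oplus0 => -[->].
  by move=> /oplus1.
case: (M2 a) => ->; rewrite ?f0 ?f1.
  by rewrite (e0mul (kmul_law M)) (e0mul (kmul_law N)).
by rewrite (e1mul (kmul_law M)) (e1mul (kmul_law N)).
Qed.

Section Bool.
Definition bool_oplus (a b : bool) : option bool :=
  if a && b then None else Some (a || b).

Fact bool_ea_le (a b : bool) : a <= b <-> exists c, bool_oplus a c = Some b.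
Proof.
split; last by case: a b => [] [] [[]].
by case: a b => [] [] // _; [exists false|exists true|exists false].
Qed.

Fact bool_oplusC a b c : bool_oplus a b = Some c -> bool_oplus b a = Some c.
Proof. by case: a; case: b. Qed.

Fact bool_oplus0 a : bool_oplus a \bot = Some a.
Proof. by case: a. Qed.

Fact bool_oplusA a b c ab s :
  bool_oplus a b = Some ab -> bool_oplus ab c = Some s ->
  exists bc, bool_oplus b c = Some bc /\ bool_oplus a bc = Some s.
Proof. by case: a; case: b => // -[<-]; case: c => // -[<-]; eexists. Qed.

Fact bool_ocomplP a b : bool_oplus a b = Some \top <-> b = ~~ a.
Proof. by case: a; case: b; split. Qed.

Fact bool_oplus1 a s : bool_oplus a \top = Some s -> a = \bot.
Proof. by case: a. Qed.

Definition bool_ea : effect_algebra bool :=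
  EffectAlgebra bool_ea_le bool_oplusC bool_oplus0 bool_oplusA
    bool_ocomplP bool_oplus1.

Lemma bool_mul_law : effect_monoid_law bool_ea andb.
Proof.
split; [exact: andbA|exact: andbT|exact: andTb| |];
  by case=> [] [] [] // s [<-].
Qed.

Lemma bool_omega : omega_complete bool.
Proof.
move=> a _; exists (`[< exists n, a n >]); split=> [_ [n _ <-]|b hb].
  case: asboolP => [_|no]; first exact: lex1.
  by case E: (a n); [case: no; exists n|exact: le0x].
case: asboolP => [[n an]|_]; last exact: le0x.
by have := hb (a n) (ex_intro2 _ _ n I erefl); rewrite an.
Qed.

Definition bool_kmonoid : kmonoid :=
  @Kmonoid (ea_kalgebra bool_ea) bool_omega bool_ea (@ea_corr _ _ bool_ea)
    andb bool_mul_law.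
End Bool.

(** * The unit interval *)

Section UnitInterval.
Import GRing.Theory Num.Theory.
Local Open Scope ring_scope.
Variable R : realType.

Lemma ui_not_initial : ~ is_initial (ui_kmonoid R).
Proof.
move=> /(_ bool_kmonoid)[f hf _].
have [||h hE] := @ui_of R 2^-1; [lra|lra|].
have : oplus (kea (ui_kmonoid R)) h h = Some \top%O.
  apply/ui_oplusP; rewrite hE; have : 2^-1 + 2^-1 = 1 :> R by lra.
  exact.
by move=> /(khom_add hf); rewrite (khom_top hf); case: (f h).
Qed.

Lemma ui_not_final : ~ is_final (ui_kmonoid R).
Proof.
move=> /is_finalP/(congr1 (fun x : unit_interval R => x%:num)).
by rewrite ui_top ui_bot; lra.
Qed.

(** The idempotent (1, 0) of a product must correspond to 0 or 1. *)
Lemma ui_irreducible : irreducible (ui_kmonoid R).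
Proof.
move=> M1 M2 [f [g [hf hg fg gf]]].
pose e : kprod M1 M2 := (\top%O, \bot%O).
have ee : kmul e e = e.
  congr pair; first exact: (emul1 (kmul_law M1)).
  exact: (emul0 (kmul_law M2)).
have : kmul (g e) (g e) = g e by rewrite -(khom_mul hg) ee.
set x : unit_interval R := g e => xx.
have : x%:num * x%:num = x%:num :> R by rewrite -[in RHS]xx.
move=> {}xx; have [x0|x1] : x%:num = 0 \/ x%:num = 1.
  have [|x0] := eqVneq x%:num 0; first by left.
  by right; apply: (mulfI x0); rewrite mulr1.
- have : g e = \bot%O by apply: ui_inj.
  rewrite -(khom_bot hg) => /(congr1 f); rewrite !gf => -[h].
  by left; apply/is_finalP.
- have : g e = \top%O by apply: ui_inj.
  rewrite -(khom_top hg) => /(congr1 f); rewrite !gf => -[h].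
  by right; apply/is_finalP.
Qed.
End UnitInterval.

Lemma kiso_unit_interval (R : realType) (M : kmonoid) :
  ~ is_initial M -> ~ is_final M -> irreducible M -> kiso M (ui_kmonoid R).
Proof.
move=> nI nF irr.
have law := kmul_law M; have omega := @komega M.
have tb : (\top : M) <> \bot by move=> /is_finalP.
have idem p (pp : kmul p (ocompl (kea M) p) = \bot) := irreducible_idempotent pp irr.
have [a a0 a1] : exists2 a : M, a <> \bot & a <> \top.
  apply: contrapT => no; apply: nI; apply: two_is_initial => // a.
  have [->|a0] := eqVneq a \bot; first by left.
  right; apply: contrapT => a1; apply: no; exists a => //; exact/eqP.
have [h hh] := half_ex law omega idem a0 a1.
pose H := half_pow (@kmul M) h.
have H0 : H 0 = \top by [].
have HS : forall n, oplus (kea M) (H n.+1) (H n.+1) = Some (H n).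
  exact (half_powS law hh).
have total := half_total law omega idem hh.
have arch := half_arch law omega idem hh.
pose phi : M -> R := state (kea M) H R.
have phi_add : forall x y z, oplus (kea M) x y = Some z -> (phi x + phi y = phi z)%R.
  exact: (@state_add _ _ (kea M) total H H0 HS tb R).
have phi_ge0 x : (0 <= phi x)%R by apply: (@state_ge0 _ _ (kea M) H H0 HS tb).
have phi_le1 x : (phi x <= 1)%R by apply: (@state_le1 _ _ (kea M) total H H0 HS tb).
have phi1 : phi \top = 1%R by apply: (@state1 _ _ (kea M) H H0 HS tb).
(* For fixed y, the map x |-> phi (x y) is additive with value phi y at 1. *)
have phi_mul x y : phi (kmul x y) = (phi x * phi y)%R.
  have g_add u v w : oplus (kea M) u v = Some w ->
      (phi (kmul u y) + phi (kmul v y) = phi (kmul w y))%R.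
    by move=> /(emulDl law y)/phi_add.
  have := @state_unique _ _ (kea M) total H H0 HS tb R _ g_add (fun u => phi_ge0 _) x.
  by rewrite (e1mul law) GRing.mulrC.
pose f (x : M) : ui_kmonoid R := Itv01 (phi_ge0 x) (phi_le1 x).
have phi_inj : injective phi.
  exact: (@state_inj _ _ (kea M) total H H0 HS tb R arch).
apply: (@kiso_bij _ _ f).
- split=> [|x y z /phi_add e|x y].
  + exact/ui_inj/phi1.
  + exact/ui_oplusP.
  + exact/ui_inj/phi_mul.
- by move=> x y /(congr1 (fun u : unit_interval R => u%:num%R)); apply: phi_inj.
- move=> t; have [x xt] : exists x, phi x = (t : unit_interval R)%:num%R.
    by apply: (@state_surj _ _ (kea M) total H H0 HS tb R arch omega).
  by exists x; apply/ui_inj/xt.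
- move=> x y z /ui_oplusP/= e; apply: (@state_perp _ _ (kea M) total H H0 HS tb R arch).
  by rewrite -/(phi x) -/(phi y) e; apply: le1.
Qed.

Theorem theorem24 (R : realType) :
  [/\ ~ is_initial (ui_kmonoid R), ~ is_final (ui_kmonoid R)
    & irreducible (ui_kmonoid R)] /\
  (forall M : kmonoid, ~ is_initial M -> ~ is_final M -> irreducible M ->
     kiso M (ui_kmonoid R)).
Proof.
split; last exact: kiso_unit_interval.
split; [exact: ui_not_initial|exact: ui_not_final|exact: ui_irreducible].
Qed.
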